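(* Let $\mathcal{P}=(L,\bar l,\mathcal{X},\mathit{inv},\mathit{prob})$ be a cdPTA, $M\in\mathbb{N}$ the upper bound on its clocks, $F\subseteq L$ a set of target locations, and $k\in\mathbb{N}$, $k\ge1$, a granularity. Let $S_F$ be the set of states $(l,v)$ of $[\![\mathcal{P}]\!]$ with $l\in F$, and for $m\in\{k,2k\}$ let $\mathsf{Regs}^F_m$ be the set of states $(l,R)$ of the clock-dependent region graph $\mathcal{A}_m$ with $l\in F$. Then: 1. $\mathbb{P}^{\max}_{[\![\mathcal{P}]\!],\mathbf{\Sigma}}(S_F)\le\mathbb{P}^{\max}_{\mathcal{A}_k,\mathbf{\Pi}_k}(\mathsf{Regs}^F_k)$ and $\mathbb{P}^{\min}_{[\![\mathcal{P}]\!],\mathbf{\Sigma}}(S_F)\ge\mathbb{P}^{\min}_{\mathcal{A}_k,\mathbf{\Pi}_k}(\mathsf{Regs}^F_k)$. 2. $\mathbb{P}^{\max}_{\mathcal{A}_{2k},\mathbf{\Pi}_{2k}}(\mathsf{Regs}^F_{2k})\le\mathbb{P}^{\max}_{\mathcal{A}_k,\mathbf{\Pi}_k}(\mathsf{Regs}^F_k)$ and $\mathbb{P}^{\min}_{\mathcal{A}_{2k},\mathbf{\Pi}_{2k}}(\mathsf{Regs}^F_{2k})\ge\mathbb{P}^{\min}_{\mathcal{A}_k,\mathbf{\Pi}_k}(\mathsf{Regs}^F_k)$.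
   Context: **Distributions.** For a set $Q$, $\mathrm{Dist}(Q)$ is the set of functions $\mu:Q\to[0,1]$ whose support $\mathrm{support}(\mu)=\{q:\mu(q)>0\}$ is countable and with $\sum_{q}\mu(q)=1$. $\{q\mapsto 1\}$ is the point distribution on $q$. **Probabilistic transition systems (PTSs).** A PTS $\mathcal{T}=(S,\bar s,\mathit{Act},\Delta)$ has a (possibly uncountable) state set $S$, an initial state $\bar s\in S$, an action set $\mathit{Act}$, and a probabilistic transition relation $\Delta\subseteq S\times \mathit{Act}\times\mathrm{Dist}(S)$; it is assumed that for each $s\in S$ there is some $(s,a,\mu)\in\Delta$. A completed transition $s\xrightarrow{a,\mu}s'$ consists of a nondeterministic choice of $(s,a,\mu)\in\Delta$ followed by a probabilistic choice of $s'$ according to $\mu$. A finite (infinite) run is a finite (infinite) sequence of consecutive transitions $s_0\xrightarrow{a_0,\mu_0}s_1\xrightarrow{a_1,\mu_1}\cdots$. A strategy $\sigma$ is a function mapping every finite run $r$ of $\mathcal{T}$ to a distribution in $\mathrm{Dist}(\Delta)$ such that $(s,a,\mu)\in\mathrm{support}(\sigma(r))$ implies that $s$ is the last state of $r$ (without loss of generality, $\mathrm{support}(\sigma(r))$ is finite for all $r$). A strategy induces in the standard way a probability measure $\mathrm{Pr}^{\sigma}_{\bar s}$ on the infinite runs from $\bar s$ resulting from its choices. For $S'\subseteq S$, $\Diamond S'$ is the set of infinite runs visiting some state of $S'$. For a set $\Sigma'$ of strategies, $\mathbb{P}^{\max}_{\mathcal{T},\Sigma'}(S')=\sup_{\sigma\in\Sigma'}\mathrm{Pr}^\sigma_{\bar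 s}(\Diamond S')$ and $\mathbb{P}^{\min}_{\mathcal{T},\Sigma'}(S')=\inf_{\sigma\in\Sigma'}\mathrm{Pr}^\sigma_{\bar s}(\Diamond S')$. **Clocks.** $\mathcal{X}$ is a finite set of clocks; valuations are functions $v:\mathcal{X}\to\mathbb{R}_{\ge0}$; $v+t$ adds $t$ to all clocks; $v[X:=0]$ sets the clocks of $X\subseteq\mathcal{X}$ to $0$; $\mathbf{0}$ is the all-zero valuation. $CC(\mathcal{X})$ is the set of clock constraints, i.e. conjunctions of atomic formulae $x\sim c$ with $x\in\mathcal{X}$, $\sim\in\{<,\le,\ge,>\}$, $c\in\mathbb{N}$; $v\models\psi$ denotes satisfaction. A distribution template over $Q$ is a function $\mathfrak{d}$ from valuations to $\mathrm{Dist}(Q)$, written $v\mapsto\mathfrak{d}[v]$. **cdPTA.** A cdPTA (clock-dependent probabilistic timed automaton) $\mathcal{P}=(L,\bar l,\mathcal{X},\mathit{inv},\mathit{prob})$ consists of a finite set $L$ of locations, an initial location $\bar l\in L$, a finite clock set $\mathcal{X}$, a map $\mathit{inv}:L\to CC(\mathcal{X})$, and a set $\mathit{prob}$ of probabilistic edges $(l,g,\mathfrak{p})$ with $l\in L$, guard $g\in CC(\mathcal{X})$ and $\mathfrak{p}$ a distribution template over $2^{\mathcal{X}}\times L$. Standing assumptions: 1. it is always possible to take a probabilistic edge, either immediately or after letting time elapse; 2. every $\mathit{inv}(l)$ contains, for each clock $x$, a constraint $x\le c$ or $x<c$; $M\in\mathbb{N}$ denotes the resulting upper bound on clocks ($v\models\mathit{inv}(l)$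 implies $v(x)\le M$ for all $l,x$); 3. if $(l,g,\mathfrak{p})\in\mathit{prob}$, $v\models g$ and $\mathfrak{p}[v](X,l')>0$, then $v[X:=0]\models\mathit{inv}(l')$; 4. if $(l,g,\mathfrak{p})\in\mathit{prob}$ and $v\models g$, then $v\models\mathit{inv}(l)$; 5. (piecewise linearity) for each $p=(l,g,\mathfrak{p})\in\mathit{prob}$, each $e\in2^{\mathcal{X}}\times L$ and each clock $x$ there is a continuous function $f^{p,e}_x$ on the interval $I^p_x=\{v(x): v\models g\}$ and a partition of $I^p_x$ into intervals with natural-number endpoints such that on each interval $I$ of the partition $f^{p,e}_x(\gamma)=c+d\gamma$ for some constants $c,d\in\mathbb{Q}$ (depending on $p,e,x,I$); for all $v\models g$ one has $\sum_{x}f^{p,e}_x(v(x))\in[0,1]$ for each $e$, $\sum_e\sum_x f^{p,e}_x(v(x))=1$, and $\mathfrak{p}[v](e)=\sum_{x\in\mathcal{X}}f^{p,e}_x(v(x))$. At a corner point $\alpha$ (defined below) in the closure of $\{v:v\models g\}$, $\mathfrak{p}[\alpha](e)=\sum_x f^{p,e}_x(\alpha(x))$ with the linear expressions for $f^{p,e}_x$ used on the closures of the intervals of the partition. **Semantics.** $[\![\mathcal{P}]\!]$ is the PTS $(S,\bar s,\mathit{Act},\Delta)$ with $S=\{(l,v): v\models\mathit{inv}(l)\}$, $\bar s=(\bar l,\mathbf{0})$, $\mathit{Act}=\mathbb{R}_{\ge0}\cup\mathit{prob}$, $\Delta=\overrightarrow{\Delta}\cup\widehat{\Delta}$, where: $\overrightarrow{\Delta}$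 consists of all $((l,v),\delta,\{(l,v+\delta)\mapsto1\})$ with $\delta\ge0$ and $v+\delta'\models\mathit{inv}(l)$ for all $0\le\delta'\le\delta$; $\widehat{\Delta}$ consists of all $((l,v),(l,g,\mathfrak{p}),\mu)$ with $v\models g$ and $\mu(l',v')=\sum_{X\subseteq\mathcal{X}:\,v[X:=0]=v'}\mathfrak{p}[v](X,l')$ for all $(l',v')\in S$. **Regions and corner points (granularity $k$).** Let $[k]=\{c/k:c\in\mathbb{N}\}$. A $k$-region is a pair $(h,[X_0,\dots,X_n])$ with $h:\mathcal{X}\to[k]\cap[0,M]$ and $[X_0,\dots,X_n]$ an (ordered) partition of $\mathcal{X}$ with $X_i\ne\emptyset$ for $1\le i\le n$, such that $h(x)=M$ implies $x\in X_0$. The $k$-region $R=(h,[X_0,\dots,X_n])$ containing a valuation $v$ (written $v\in R$) is the one satisfying: (i) $\lfloor k v(x)\rfloor=k h(x)$ for all $x$; (ii) $v(x)=h(x)$ iff $x\in X_0$; (iii) $k v(x)-\lfloor k v(x)\rfloor\le k v(y)-\lfloor k v(y)\rfloor$ iff $x\in X_i$ and $y\in X_j$ with $i\le j$, for all clocks $x,y$. $\mathsf{Regs}_k$ is the set of $k$-regions; $R_{\mathbf{0}}$ is the one containing $\mathbf{0}$; $R[X:=0]$ is the $k$-region containing the valuations $v[X:=0]$ for $v\in R$; $R\models\psi$ means that the valuations in $R$ satisfy $\psi$. $R'$ is a $\psi$-satisfying time successor of $R$ if there are $v\in R$, $\delta\ge0$ with $v+\delta\in R'$ and $v+\delta'\models\psi$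 for all $0\le\delta'\le\delta$. The corner points of $R=(h,[X_0,\dots,X_n])$ are the $n+1$ valuations $a_0,\dots,a_n$ with $a_i(x)=h(x)$ if $x\in X_j$ with $j\le i$, and $a_i(x)=h(x)+\frac1k$ if $x\in X_j$ with $j>i$; $\mathsf{CP}(R)$ is their set, and $\mathsf{CornerPoints}_k$ is the set of all corner points of $k$-regions. **Clock-dependent region graph.** $\mathcal{A}_k$ is the finite-state PTS with state set $\mathsf{S}_k=L\times\mathsf{Regs}_k$, initial state $(\bar l,R_{\mathbf{0}})$, actions $\{\tau\}\cup(\mathsf{CornerPoints}_k\times\mathit{prob})$, and transitions $\overrightarrow{\Gamma_k}\cup\widehat{\Gamma_k}$, where $\overrightarrow{\Gamma_k}$ consists of all $((l,R),\tau,\{(l,R')\mapsto1\})$ with $R'$ an $\mathit{inv}(l)$-satisfying time successor of $R$, and $\widehat{\Gamma_k}$ consists of all $((l,R),(\alpha,(l,g,\mathfrak{p})),\nu)$ with $R\models g$, $\alpha\in\mathsf{CP}(R)$ and $\nu(l',R')=\sum_{X\subseteq\mathcal{X}:\,R[X:=0]=R'}\mathfrak{p}[\alpha](X,l')$ for all $(l',R')\in\mathsf{S}_k$. $\mathcal{A}_{2k}$ etc. are defined with $2k$ in place of $k$. **Strategy classes.** $\mathbf{\Sigma}$ (cdPTA strategies) is the set of strategies $\sigma$ of $[\![\mathcal{P}]\!]$ such that, for a finite run $r$ of $[\![\mathcal{P}]\!]$ with final transition $s\xrightarrow{a,\mu}s'$, either $(s,a,\mu)\in\overrightarrow{\Delta}$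 and $\mathrm{support}(\sigma(r))\subseteq\widehat{\Delta}$, or $(s,a,\mu)\in\widehat{\Delta}$ and $\mathrm{support}(\sigma(r))\subseteq\overrightarrow{\Delta}$. $\mathbf{\Pi}_k$ (region graph strategies) is the set of strategies of $\mathcal{A}_k$ defined in the same way, with $\overrightarrow{\Gamma_k},\widehat{\Gamma_k}$ in place of $\overrightarrow{\Delta},\widehat{\Delta}$. *)

(* Defs.v *)
From HB Require Import structures.
From mathcomp Require Import all_boot all_order all_algebra.
From mathcomp Require Import all_classical all_reals all_analysis.
Set Implicit Arguments.
Unset Strict Implicit.
Unset Printing Implicit Defensive.
Import Order.TTheory GRing.Theory Num.Theory.
Import numFieldNormedType.Exports.
Local Open Scope classical_set_scope.
Local Open Scope ring_scope.

(** * Distributions with countable support *)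

Record Dist (R : realType) (Q : choiceType) := MkDist {
  dist_val :> Q -> R;
  dist_01 : forall q, 0 <= dist_val q <= 1;
  dist_countable : countable [set q | 0 < dist_val q];
  dist_sum1 : (\esum_(q in [set: Q]) (dist_val q)%:E = 1)%E }.

HB.instance Definition _ R Q := gen_eqMixin (Dist R Q).
HB.instance Definition _ R Q := gen_choiceMixin (Dist R Q).

Definition supp (R : realType) (Q : choiceType) (mu : Dist R Q) : set Q :=
  [set q | 0 < mu q].

Section PointDist.
Variables (R : realType) (Q : choiceType) (q : Q).

Let f (q' : Q) : R := (q' == q)%:R.

Fact point_dist_01 q' : 0 <= f q' <= 1.
Proof. by rewrite /f; case: (q' == q); rewrite ?lexx ler01. Qed.

Fact point_dist_countable : countable [set q' | 0 < f q'].
Proof.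
apply: (@sub_countable _ _ _ [set q]); last exact: finite_set_countable.
by apply: subset_card_le => q' /=; rewrite /f; case: eqP; rewrite ?ltxx.
Qed.

Fact point_dist_sum1 : (\esum_(q' in [set: Q]) (f q')%:E = 1)%E.
Proof.
rewrite -(@esum_set1 R Q q (fun=> 1%E)) // [RHS]esum_mkcond.
apply: eq_esum => q' _; rewrite /f; case: eqP => [->|ne].
  by rewrite mem_set.
by rewrite memNset.
Qed.

Definition point_dist : Dist R Q :=
  MkDist point_dist_01 point_dist_countable point_dist_sum1.
End PointDist.

(** * Probabilistic transition systems *)

(* Every state that occurs on a run from the initial state should have an
   outgoing transition.  This is not a field: a region graph also has states
   (l, R) in which R violates the invariant of l; they are unreachable, and
   they have no outgoing transition. *)
Record pts (R : realType) := PTS {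
  state : choiceType;
  init : state;
  act : pointedType;
  Delta : set (state * act * Dist R state) }.

Section PTSRuns.
Variables (R : realType) (T : pts R).

Definition trans : Type := (state T * act T * Dist R (state T))%type.
HB.instance Definition _ := Choice.on trans.

(* (a, mu, s') is what a completed transition s --(a,mu)--> s' adds to a run
   whose last state is s. *)
Definition step : Type := (act T * Dist R (state T) * state T)%type.
HB.instance Definition _ := Choice.on step.

(* All runs considered start in [init T], which is therefore not stored. *)
Definition last_state (r : seq step) : state T :=
  last (init T) [seq st.2 | st <- r].

Definition trans_after (r : seq step) (st : step) : trans :=
  (last_state r, st.1.1, st.1.2).

Definition is_run (r : seq step) : Prop :=
  forall r1 st r2, r = rcons r1 st ++ r2 ->
    Delta (trans_after r1 st) /\ supp st.1.2 st.2.

(* The value on sequences of steps that are not runs is irrelevant. *)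
Definition strategy : Type := seq step -> Dist R trans.

Definition is_strategy (sigma : strategy) : Prop :=
  forall r, is_run r ->
    finite_set (supp (sigma r)) /\
    (forall t, supp (sigma r) t -> Delta t /\ t.1.1 = last_state r).

Fixpoint weight_after (sigma : strategy) (h r : seq step) : R :=
  if r is st :: r' then
    sigma h (trans_after h st) * st.1.2 st.2 * weight_after sigma (rcons h st) r'
  else 1.

(* The product of the probabilities of all nondeterministic and probabilistic
   choices made along r. *)
Definition weight (sigma : strategy) (r : seq step) : R :=
  weight_after sigma [::] r.

Definition prefix_of (w : nat -> step) (n : nat) : seq step := mkseq w n.

Definition infinite_run (w : nat -> step) : Prop :=
  forall n, is_run (prefix_of w n).

Definition step_seq : Type := nat -> step.
HB.instance Definition _ := gen_eqMixin step_seq.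
HB.instance Definition _ := gen_choiceMixin step_seq.
HB.instance Definition _ :=
  isPointed.Build step_seq (fun=> (point, point_dist R (init T), init T)).

(* The base A of a cylinder is an arbitrary set of finite sequences: since the
   state set may be uncountable, the sets [set w | prefix_of w n = r] alone
   would not generate a sigma-algebra in which reachability is measurable. *)
Definition cylinders : set (set step_seq) :=
  [set E | exists n (A : set (seq step)), E = [set w | A (prefix_of w n)]].

Definition run_space := g_sigma_algebraType cylinders.

(* By the Ionescu-Tulcea theorem exactly one probability measure satisfies this
   when sigma is a strategy; the measure is carried by the infinite runs. *)
Definition induces (sigma : strategy) (P : probability run_space R) : Prop :=
  forall r : seq step,
    P [set w | prefix_of w (size r) = r] = (weight sigma r)%:E.

Definition reach (S' : set (state T)) : set run_space :=
  [set w | infinite_run w /\ exists n, S' (last_state (prefix_of w n))].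

Definition reach_values (C : set strategy) (S' : set (state T)) : set (\bar R) :=
  [set y | exists (sigma : strategy) (P : probability run_space R),
     [/\ C sigma, induces sigma P & y = P (reach S')]].

Definition Pmax (C : set strategy) (S' : set (state T)) : \bar R :=
  ereal_sup (reach_values C S').

Definition Pmin (C : set strategy) (S' : set (state T)) : \bar R :=
  ereal_inf (reach_values C S').

(* Alternation is required on the finite runs that sigma itself generates with
   positive probability.  On other runs the requirement may be unsatisfiable
   (e.g. after a delay to a state in which no guard holds) and it has no
   influence on the measure induced by sigma. *)
Definition alternating_strategies (D1 D2 : set trans) : set strategy :=
  [set sigma | is_strategy sigma /\
    forall r st, is_run (rcons r st) -> 0 < weight sigma (rcons r st) ->
      (D1 (trans_after r st) /\ supp (sigma (rcons r st)) `<=` D2) \/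
      (D2 (trans_after r st) /\ supp (sigma (rcons r st)) `<=` D1)].
End PTSRuns.

(** * Clocks *)

Variant cmp := CLt | CLe | CGe | CGt.
HB.instance Definition _ := gen_eqMixin cmp.
HB.instance Definition _ := gen_choiceMixin cmp.

Definition clock_constraint (X : finType) := seq (X * cmp * nat).

Section Clocks.
Variables (R : realType) (X : finType).

Definition valuation : Type := {ffun X -> {nonneg R}}.
HB.instance Definition _ := Choice.on valuation.

Definition val0 : valuation := [ffun=> 0%:nng].

Definition elapse (v : valuation) (t : {nonneg R}) : valuation :=
  [ffun x => ((v x)%:num + t%:num)%:nng].

Definition reset (v : valuation) (Y : {set X}) : valuation :=
  [ffun x => if x \in Y then 0%:nng else v x].

Definition atom_sat (v : valuation) (a : X * cmp * nat) : bool :=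
  let: (x, op, c) := a in
  match op with
  | CLt => (v x)%:num < c%:R
  | CLe => (v x)%:num <= c%:R
  | CGe => (v x)%:num >= c%:R
  | CGt => (v x)%:num > c%:R
  end.

Definition sat (v : valuation) (psi : clock_constraint X) : bool :=
  all (atom_sat v) psi.

Definition clock_range (psi : clock_constraint X) (x : X) : set R :=
  [set (v x)%:num | v in [set v : valuation | sat v psi]].
End Clocks.

(** * Piecewise linear functions *)

(* (i, c, d) stands for the function gamma |-> c + d * gamma on i. *)
Definition piece : Type := (interval nat * rat * rat)%type.

Section Pieces.
Variable R : realType.

Definition piece_dom (q : piece) : set R :=
  [set` map_itv (fun n : nat => n%:R : R) q.1.1].

Definition piece_val (q : piece) (gamma : R) : R :=
  ratr q.1.2 + ratr q.2 * gamma.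

Definition piece0 : piece := (`]0%N, 0%N[, 0, 0).

Definition is_partition (qs : seq piece) (I : set R) : Prop :=
  [/\ forall i, (i < size qs)%N -> piece_dom (nth piece0 qs i) !=set0,
      trivIset [set i | (i < size qs)%N] (fun i => piece_dom (nth piece0 qs i)) &
      \bigcup_(i in [set i | (i < size qs)%N]) piece_dom (nth piece0 qs i) = I].

(* The value at gamma of the linear expression of a piece whose closure contains
   gamma.  If the pieces partition an interval and represent a continuous
   function on it, then all such pieces give the same value. *)
Definition closure_val (qs : seq piece) (gamma : R) : R :=
  piece_val
    (nth piece0 qs (find (fun q => `[< closure (piece_dom q) gamma >]) qs))
    gamma.
End Pieces.

(** * Clock-dependent probabilistic timed automata *)

Record edge (R : realType) (X L : finType) := Edge {
  src : L;
  guard : clock_constraint X;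
  template : valuation R X -> Dist R ({set X} * L)%type }.

(* [pl_fun p e x] and [pl_pieces p e x] are the function f^{p,e}_x and its
   partition, with the coefficients of the linear expressions. *)
Record cdpta (R : realType) (X L : finType) := CdPTA {
  loc0 : L;
  inv : L -> clock_constraint X;
  prob : set (edge R X L);
  pl_fun : edge R X L -> {set X} * L -> X -> R -> R;
  pl_pieces : edge R X L -> {set X} * L -> X -> seq piece;
  inv_loc0 : sat (val0 R X) (inv loc0);
  can_take_edge : forall l (v : valuation R X), sat v (inv l) ->
    exists2 t : {nonneg R},
      (forall t' : {nonneg R}, t'%:num <= t%:num -> sat (elapse v t') (inv l)) &
      exists2 p, prob p & src p = l /\ sat (elapse v t) (guard p);
  inv_bounded : forall l x, exists c,
    ((x, CLe, c) \in inv l) || ((x, CLt, c) \in inv l);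
  target_inv : forall p (v : valuation R X) Y l', prob p -> sat v (guard p) ->
    0 < template p v (Y, l') -> sat (reset v Y) (inv l');
  guard_inv : forall p (v : valuation R X), prob p -> sat v (guard p) -> sat v (inv (src p));
  pl_continuous : forall p e x, prob p ->
    {within clock_range (guard p) x, continuous (pl_fun p e x)};
  pl_partition : forall p e x, prob p ->
    is_partition (pl_pieces p e x) (clock_range (guard p) x : set R);
  pl_linear : forall p e x q (gamma : R), prob p -> q \in pl_pieces p e x ->
    piece_dom q gamma -> pl_fun p e x gamma = piece_val q gamma;
  pl_01 : forall p (v : valuation R X) e, prob p -> sat v (guard p) ->
    0 <= \sum_x pl_fun p e x (v x)%:num <= 1;
  pl_sum1 : forall p (v : valuation R X), prob p -> sat v (guard p) ->
    \sum_e \sum_x pl_fun p e x (v x)%:num = 1;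
  pl_template : forall p (v : valuation R X) e, prob p -> sat v (guard p) ->
    template p v e = \sum_x pl_fun p e x (v x)%:num }.

Section Semantics.
Variables (R : realType) (X L : finType) (P : cdpta R X L).

Definition clock_bound (M : nat) : Prop :=
  forall l (v : valuation R X) x, sat v (inv P l) -> (v x)%:num <= M%:R.

Definition sem_state : Type := {s : L * valuation R X | sat s.2 (inv P s.1)}.
HB.instance Definition _ := Choice.on sem_state.

Definition loc (s : sem_state) : L := (val s).1.
Definition clk (s : sem_state) : valuation R X := (val s).2.

Definition sem_init : sem_state :=
  exist (fun s : L * valuation R X => sat s.2 (inv P s.1))
    (loc0 P, val0 R X) (inv_loc0 P).

Variant sem_act := Delay of {nonneg R} | Take of edge R X L.
HB.instance Definition _ := gen_eqMixin sem_act.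
HB.instance Definition _ := gen_choiceMixin sem_act.
HB.instance Definition _ := isPointed.Build sem_act (Delay 0%:nng).

Definition sem_delay : set (sem_state * sem_act * Dist R sem_state) :=
  [set t | exists (s s' : sem_state) (d : {nonneg R}),
    [/\ t = (s, Delay d, point_dist R s'),
        loc s' = loc s, clk s' = elapse (clk s) d &
        forall d' : {nonneg R}, d'%:num <= d%:num ->
          sat (elapse (clk s) d') (inv P (loc s))]].

Definition sem_prob : set (sem_state * sem_act * Dist R sem_state) :=
  [set t | exists (s : sem_state) (p : edge R X L) (mu : Dist R sem_state),
    [/\ t = (s, Take p, mu), prob P p, src p = loc s, sat (clk s) (guard p) &
        forall s' : sem_state,
          mu s' = \sum_(Y : {set X} | reset (clk s) Y == clk s')
                    template p (clk s) (Y, loc s')]].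

Definition sem : pts R := PTS sem_init (sem_delay `|` sem_prob).

Definition cdpta_strategies : set (strategy sem) :=
  @alternating_strategies R sem sem_delay sem_prob.

Definition sem_target (F : {set L}) : set (state sem) :=
  [set s : sem_state | loc s \in F].

(** ** Regions of granularity k *)

Section Regions.
Variables k M : nat.

(* [reg_h] is k * h, so that h takes its values in [k] /\ [0, M]; [reg_parts] is
   the list [X_0, ..., X_n]. *)
Definition region_ok (h : {ffun X -> 'I_(k * M).+1}) (parts : seq {set X}) : bool :=
  [&& parts != [::],
      finset.set0 \notin behead parts,
      pairwise (fun A B : {set X} => (A :&: B)%SET == finset.set0) parts,
      (\bigcup_(A <- parts) A)%SET == [set: X]%SET &
      [forall x, (h x == (k * M)%N :> nat) ==> (x \in head finset.set0 parts)]].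

Record region := Region {
  reg_h : {ffun X -> 'I_(k * M).+1};
  reg_parts : seq {set X};
  reg_ok : region_ok reg_h reg_parts }.
HB.instance Definition _ := gen_eqMixin region.
HB.instance Definition _ := gen_choiceMixin region.

(* The index i with x \in X_i; X_0 may be empty, so the first part of a
   region without clocks in X_0 is the empty set. *)
Definition block (r : region) (x : X) : nat :=
  find (fun A : {set X} => x \in A) (reg_parts r).

Definition hval (r : region) (x : X) : {nonneg R} :=
  ((reg_h r x)%:R / k%:R)%:nng.

Definition kfrac (v : valuation R X) (x : X) : R :=
  k%:R * (v x)%:num - (Num.floor (k%:R * (v x)%:num))%:~R.

Definition in_region (v : valuation R X) (r : region) : Prop :=
  [/\ forall x, Num.floor (k%:R * (v x)%:num) = (reg_h r x)%:Z,
      forall x, v x = hval r x <-> block r x = 0%N &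
      forall x y, kfrac v x <= kfrac v y <-> (block r x <= block r y)%N].

Fact region0_ok : region_ok [ffun=> ord0] [:: [set: X]%SET].
Proof.
rewrite /region_ok /= big_seq1 eqxx /=.
by apply/forallP => x; rewrite inE implybT.
Qed.

Definition region0 : region := Region region0_ok.

Definition is_reset (r : region) (Y : {set X}) (r' : region) : Prop :=
  forall v, in_region v r -> in_region (reset v Y) r'.

Definition region_sat (r : region) (psi : clock_constraint X) : Prop :=
  forall v, in_region v r -> sat v psi.

Definition time_succ (psi : clock_constraint X) (r r' : region) : Prop :=
  exists (v : valuation R X) (d : {nonneg R}),
    [/\ in_region v r, in_region (elapse v d) r' &
        forall d' : {nonneg R}, d'%:num <= d%:num -> sat (elapse v d') psi].

Definition corner (r : region) (i : nat) : valuation R X :=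
  [ffun x => if (block r x <= i)%N then hval r x
             else ((hval r x)%:num + k%:R^-1)%:nng].

Definition corner_points (r : region) : set (valuation R X) :=
  [set corner r i | i in [set i | (i < size (reg_parts r))%N]].

Definition corner_prob (p : edge R X L) (alpha : valuation R X)
    (e : {set X} * L) : R :=
  \sum_x closure_val (pl_pieces P p e x) (alpha x)%:num.

(** ** Clock-dependent region graph *)

Definition rg_state : Type := (L * region)%type.
HB.instance Definition _ := Choice.on rg_state.

(* As for [sem_act], the type is larger than the action set: the transitions
   use only edges in [prob P] and corner points. *)
Variant rg_act := Tau | Corner of valuation R X & edge R X L.
HB.instance Definition _ := gen_eqMixin rg_act.
HB.instance Definition _ := gen_choiceMixin rg_act.
HB.instance Definition _ := isPointed.Build rg_act Tau.

Definition rg_delay : set (rg_state * rg_act * Dist R rg_state) :=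
  [set t | exists (l : L) (r r' : region),
    t = ((l, r), Tau, point_dist R ((l, r') : rg_state)) /\
    time_succ (inv P l) r r'].

Definition rg_prob : set (rg_state * rg_act * Dist R rg_state) :=
  [set t | exists (l : L) (r : region) (alpha : valuation R X)
      (p : edge R X L) (nu : Dist R rg_state),
    [/\ t = ((l, r), Corner alpha p, nu),
        prob P p /\ src p = l, region_sat r (guard p), corner_points r alpha &
        forall (l' : L) (r' : region),
          nu (l', r') = \sum_(Y : {set X} | `[< is_reset r Y r' >])
                          corner_prob p alpha (Y, l')]].

Definition region_graph : pts R :=
  @PTS R rg_state (loc0 P, region0) rg_act (rg_delay `|` rg_prob).

Definition region_strategies : set (strategy region_graph) :=
  @alternating_strategies R region_graph rg_delay rg_prob.

Definition region_target (F : {set L}) : set (state region_graph) :=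
  [set s : rg_state | s.1 \in F].
End Regions.
End Semantics.

Arguments sem_target {R X L} P F _.
Arguments cdpta_strategies {R X L} P _.
Arguments region_strategies {R X L} P k M _.
Arguments region_target {R X L} P k M F _.

(* Main.v *)
Require Import Defs.
From HB Require Import structures.
From mathcomp Require Import all_boot all_order all_algebra.
From mathcomp Require Import all_classical all_reals all_analysis.
From mathcomp Require Import finmap ring lra.
Set Implicit Arguments.
Unset Strict Implicit.
Unset Printing Implicit Defensive.
Import Order.TTheory GRing.Theory Num.Theory.
Import numFieldNormedType.Exports.
Local Open Scope classical_set_scope.
Local Open Scope ring_scope.

(** Both parts are instances of one fact: a map h between the states of two
    systems that lifts every transition t to a randomised choice between
    transitions of the target whose overall effect is the image of t under h
    makes every reachability probability of the source one of the target.
    Given a strategy of the source, the target plays the conditional expectation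
    of its lifted choices, given the run of the target seen so far; the joint
    weights of a run of the target and the runs of the source lying over it then
    have both strategies' run weights as marginals.  A measure induced by the
    resulting finitely branching strategy is the image of Lebesgue measure on
    [0, 1[ under repeated subdivision.

    For the region graph, h sends a valuation (or a 2k-region) to its k-region.
    A point of a closed region is a convex combination of the corners, and
    continuity together with the integer endpoints of the pieces makes
    [corner_prob] affine on the closed region; so a probabilistic edge taken at
    that point is the corresponding mixture of its corner transitions. *)

(** * Finitely supported distributions and positive runs *)

(** Reachability values range over pairs of a strategy and a measure that it induces, so a measure
    has to be exhibited for the target strategy too. Strategies and transitions have finite
    supports; hence each length has finitely many runs of positive weight, and the measure of a
    prefix event is a finite sum although there may be uncountably many states. The map [h] is not
    injective: a target run leaves open which source run lies over it. Averaging over these still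
    alternates, because the kind of the last target transition fixes the kind of the last source
    transition in all of them. A corner may violate the guard, so no assumption on the automaton
    speaks about [corner_prob] there. Sign and total mass are carried to the boundary along segments
    that end at a point of the region, on which all data are affine. *)

Section FiniteDistributions.
Variables (R : realType) (Q : choiceType).
Implicit Types (d : Dist R Q) (l : seq (R * Q)).

Definition enumD d : seq Q := fset_set (supp d).

Lemma dist_ge0 d q : 0 <= d q.
Proof. by have /andP[] := dist_01 d q. Qed.

Lemma enumD_uniq d : uniq (enumD d).
Proof. exact: fset_uniq. Qed.

Lemma mem_enumD d q : finite_set (supp d) -> (q \in enumD d) = (0 < d q).
Proof.
move=> fd; rewrite /enumD in_fset_set//; apply/idP/idP => [/set_mem//|h].
exact/mem_set.
Qed.

Lemma enumD_sum1 d : finite_set (supp d) -> \sum_(q <- enumD d) d q = 1.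
Proof.
move=> fd; have /eqP := dist_sum1 d.
rewrite (_ : (\esum_(q in [set: Q]) (d q)%:E = \esum_(q in supp d) (d q)%:E)%E).
  rewrite esum_fset//; last by move=> i _; rewrite lee_fin dist_ge0.
  by rewrite fsbig_finite//= sumEFin eqe => /eqP.
rewrite [RHS]esum_mkcond; apply: eq_esum => q _.
case: ifPn => // /negP; rewrite in_setE /supp /= => /negP.
by rewrite -leNgt => h; congr (_%:E); apply/le_anti; rewrite h dist_ge0.
Qed.

(** A weighted list stands for a sum of point masses. Repeated points add their weights, so images
    and mixtures are formed on lists without merging coincident points. *)
Definition wmass l (q : Q) : R := \sum_(z <- l | z.2 == q) z.1.

Lemma wmass_sum (E : seq Q) l (f : Q -> R) : uniq E ->
  {in l, forall z, z.1 != 0 -> z.2 \in E} ->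
  \sum_(x <- E) wmass l x * f x = \sum_(z <- l) z.1 * f z.2.
Proof.
move=> uE lE.
under eq_bigr => x _ do rewrite /wmass big_mkcond/= mulr_suml.
rewrite exchange_big/= [LHS]big_seq [RHS]big_seq; apply: eq_bigr => z zl.
have [z0|z0] := eqVneq z.1 0.
  by rewrite z0 mul0r big1// => x _; rewrite if_same mul0r.
rewrite (bigD1_seq z.2)//=; last exact: lE.
rewrite eqxx big1 ?addr0// => x xz.
by rewrite eq_sym (negbTE xz) mul0r.
Qed.

Lemma wmass_ge0 l q : {in l, forall z, 0 <= z.1} -> 0 <= wmass l q.
Proof.
by move=> l0; rewrite /wmass big_seq_cond sumr_ge0// => z /andP[zl _]; exact: l0.
Qed.

Lemma wmass_gt0P l q : {in l, forall z, 0 <= z.1} ->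
  0 < wmass l q -> exists2 z, z \in l & z.2 = q /\ 0 < z.1.
Proof.
move=> l0; rewrite /wmass; elim: l l0 => [|z l IH] l0.
  by rewrite big_nil ltxx.
have l0' : {in l, forall z, 0 <= z.1}.
  by move=> y yl; apply: l0; rewrite inE yl orbT.
rewrite big_cons; case: eqP => [zq|_].
  have [z0|z0] := ltP 0 z.1; first by exists z; rewrite ?inE ?eqxx.
  have -> : z.1 = 0 by apply/le_anti; rewrite z0 l0// inE eqxx.
  rewrite add0r => /(IH l0')[y yl ?]; exists y => //; by rewrite inE yl orbT.
by move=> /(IH l0')[y yl ?]; exists y => //; rewrite inE yl orbT.
Qed.

Lemma wmass_gt0 l z : {in l, forall z, 0 <= z.1} -> z \in l -> 0 < z.1 ->
  0 < wmass l z.2.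
Proof.
move=> l0 zl z0; rewrite /wmass (big_rem z)//= eqxx ltr_pwDl//.
by apply: wmass_ge0 => y /mem_rem; exact: l0.
Qed.

Lemma finite_supp_wmass d l : {in l, forall z, 0 <= z.1} ->
  (forall q, d q = wmass l q) -> finite_set (supp d).
Proof.
move=> l0 dl; apply: (@sub_finite_set _ _ [set` map snd l]) => //.
move=> q /=; rewrite /supp/= dl => /(wmass_gt0P l0)[z zl [<- _]].
exact: map_f.
Qed.

Section MakeDist.
Variable l : seq (R * Q).
Hypotheses (l0 : {in l, forall z, 0 <= z.1}) (l1 : \sum_(z <- l) z.1 = 1).

Let fin : finite_set [set q | 0 < wmass l q].
Proof.
apply: (@sub_finite_set _ _ [set` map snd l]) => //.
by move=> q /= /(wmass_gt0P l0)[z zl [<- _]]; exact: map_f.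
Qed.

Fact wdist_01 q : 0 <= wmass l q <= 1.
Proof.
rewrite wmass_ge0//= -l1 /wmass big_mkcond/= big_seq [leRHS]big_seq.
by apply: ler_sum => z zl; case: ifP => // _; exact: l0.
Qed.

Fact wdist_countable : countable [set q | 0 < wmass l q].
Proof. exact: finite_set_countable. Qed.

Fact wdist_sum1 : (\esum_(q in [set: Q]) (wmass l q)%:E = 1)%E.
Proof.
transitivity (\esum_(q in [set q | (0 < wmass l q)%R]) (wmass l q)%:E)%E.
  rewrite [RHS]esum_mkcond; apply: eq_esum => q _.
  case: ifPn => // /negP; rewrite in_setE /= => /negP.
  by rewrite -leNgt => h; congr (_%:E); apply/le_anti; rewrite h wmass_ge0.
rewrite esum_fset//; last by move=> i _; rewrite lee_fin wmass_ge0.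
rewrite fsbig_finite//= sumEFin; congr (_%:E).
under eq_bigr do rewrite -[wmass _ _]mulr1.
rewrite (@wmass_sum _ l (fun=> 1)) ?fset_uniq//; first by under eq_bigr do rewrite mulr1.
move=> z zl z0; rewrite in_fset_set//; apply/mem_set => /=.
by apply: wmass_gt0 => //; rewrite lt_neqAle eq_sym z0 l0.
Qed.

Definition wdist : Dist R Q := MkDist wdist_01 wdist_countable wdist_sum1.
End MakeDist.

Lemma sum_enumD d l (f : Q -> R) : {in l, forall z, 0 <= z.1} ->
  (forall q, d q = wmass l q) ->
  \sum_(q <- enumD d) d q * f q = \sum_(z <- l) z.1 * f z.2.
Proof.
move=> l0 dl; under eq_bigr do rewrite dl.
apply: wmass_sum; first exact: enumD_uniq.
move=> z zl z0; rewrite mem_enumD; last exact: finite_supp_wmass dl.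
by rewrite dl wmass_gt0// lt_neqAle eq_sym z0 l0.
Qed.

End FiniteDistributions.

(** * Finite enumeration of the runs of positive weight *)

Section Runs.
Variables (R : realType) (T : pts R) (sigma : strategy T).
Hypothesis sS : is_strategy sigma.
Hypothesis FS : forall t : trans T, Delta t -> finite_set (supp t.2).
Implicit Types (r : seq (step T)) (st : step T).

Definition steps r : seq (step T) :=
  [seq (t.1.2, t.2, s') | t <- enumD (sigma r), s' <- enumD t.2].

Fixpoint runs n : seq (seq (step T)) :=
  if n is m.+1 then [seq rcons r st | r <- runs m, st <- steps r] else [:: [::]].

Lemma last_state_rcons r st : last_state (rcons r st) = st.2.
Proof. by rewrite /last_state map_rcons last_rcons. Qed.

Definition sprob r st : R := sigma r (trans_after r st) * st.1.2 st.2.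

Lemma sprob_ge0 r st : 0 <= sprob r st.
Proof. by rewrite mulr_ge0 ?dist_ge0. Qed.

Lemma sprob_gt0 r st : (0 < sprob r st) =
  (0 < sigma r (trans_after r st)) && (0 < st.1.2 st.2).
Proof. by rewrite mulr_ge0_gt0 ?dist_ge0. Qed.

Lemma weight_rcons r st : weight sigma (rcons r st) = weight sigma r * sprob r st.
Proof.
rewrite /weight; suff H h : weight_after sigma h (rcons r st) =
    weight_after sigma h r * sprob (h ++ r) st by rewrite H.
elim: r h => [|a r IH] h /=; first by rewrite cats0 mulr1 mul1r.
by rewrite IH -!mulrA cat_rcons.
Qed.

Lemma weight_ge0 r : 0 <= weight sigma r.
Proof.
elim/last_ind: r => [|r st IH]; first by rewrite /weight ler01.
by rewrite weight_rcons mulr_ge0// sprob_ge0.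
Qed.

Lemma is_run_nil : @is_run R T [::].
Proof. by move=> r1 st [|? ?] /(congr1 size); rewrite size_cat size_rcons. Qed.

Lemma is_run_rcons r st : is_run (rcons r st) <->
  is_run r /\ Delta (trans_after r st) /\ supp st.1.2 st.2.
Proof.
split=> [H|[H1 H2]].
  split; last by apply: (H _ _ [::]); rewrite cats0.
  by move=> r1 st1 r2 E; apply: (H r1 st1 (rcons r2 st)); rewrite -rcons_cat -E.
move=> r1 st1 r2; elim/last_ind: r2 => [|r2 a _].
  by rewrite cats0 => /rcons_inj[<- <-].
by rewrite -rcons_cat => /rcons_inj[E _]; exact: (H1 _ _ r2).
Qed.

Lemma trans_eta r (t : trans T) (s : state T) : t.1.1 = last_state r ->
  trans_after r (t.1.2, t.2, s) = t.
Proof. by case: t => [[? ?] ?] /= ->. Qed.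

Lemma weight_is_run r : 0 < weight sigma r -> is_run r.
Proof.
elim/last_ind: r => [|r st IH]; first by move=> _; exact: is_run_nil.
rewrite weight_rcons mulr_ge0_gt0 ?weight_ge0 ?sprob_ge0// sprob_gt0.
move=> /and3P[/IH rr s0 m0]; apply/is_run_rcons; split=> //; split=> //.
by have [_ /(_ _ s0)[]] := sS rr.
Qed.

Lemma finite_sigma r : is_run r -> finite_set (supp (sigma r)).
Proof. by move=> /sS[]. Qed.

Lemma sigma_Delta r t : is_run r -> 0 < sigma r t -> Delta t /\ t.1.1 = last_state r.
Proof. by move=> /sS[_ h] /h. Qed.

Lemma mem_steps r st : is_run r -> (st \in steps r) = (0 < sprob r st).
Proof.
move=> rr; apply/allpairsPdep/idP => [[t [s' [tE sE ->]]]|].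
  have t0 : 0 < sigma r t by rewrite -mem_enumD//; exact: finite_sigma.
  have [Dt tl] := sigma_Delta rr t0.
  rewrite sprob_gt0 /= trans_eta// t0 -mem_enumD//; exact: FS.
rewrite sprob_gt0 => /andP[t0 m0].
have [Dt _] := sigma_Delta rr t0.
exists (trans_after r st), st.2; split.
- by rewrite mem_enumD//; exact: finite_sigma.
- by rewrite mem_enumD//; exact: FS Dt.
- by case: st {t0 m0 Dt} => -[].
Qed.

(** A step omits its source state, but every transition that [sigma r] can choose starts at
    [last_state r], so distinct transitions give distinct steps. *)
Lemma steps_uniq r : is_run r -> uniq (steps r).
Proof.
move=> rr; apply: allpairs_uniq_dep; first exact: enumD_uniq.
  by move=> x _; exact: enumD_uniq.
move=> [t s] [t' s'] /allpairsPdep[t1 [s1 [t1E _ [-> ->]]]].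
move=> /allpairsPdep[t2 [s2 [t2E _ [-> ->]]]] /=.
have D t0 : t0 \in enumD (sigma r) -> t0.1.1 = last_state r.
  by rewrite mem_enumD; [move=> /(sigma_Delta rr)[]|exact: finite_sigma].
move: (D _ t1E) (D _ t2E).
by case: t1 {t1E} => [[? ?] ?]; case: t2 {t2E} => [[? ?] ?] /= -> -> [-> -> ->].
Qed.

Lemma sum_steps r (f : step T -> R) : is_run r ->
  \sum_(st <- steps r) sprob r st * f st =
  \sum_(t <- enumD (sigma r)) sigma r t *
     \sum_(s' <- enumD t.2) t.2 s' * f (t.1.2, t.2, s').
Proof.
move=> rr; rewrite big_allpairs_dep/= [LHS]big_seq [RHS]big_seq.
apply: eq_bigr => t tE; rewrite big_distrr/=; apply: eq_bigr => s _.
rewrite mulrA /sprob /= trans_eta//.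
by move: tE; rewrite mem_enumD; [move=> /(sigma_Delta rr)[]|exact: finite_sigma].
Qed.

Lemma steps_sum1 r : is_run r -> \sum_(st <- steps r) sprob r st = 1.
Proof.
move=> rr; under eq_bigr do rewrite -[sprob _ _]mulr1.
rewrite (sum_steps (fun=> 1))// -[RHS](enumD_sum1 (finite_sigma rr)).
rewrite [LHS]big_seq [RHS]big_seq; apply: eq_bigr => t tE.
under eq_bigr do rewrite mulr1.
rewrite enumD_sum1 ?mulr1//; apply: FS.
by move: tE; rewrite mem_enumD; [move=> /(sigma_Delta rr)[]|exact: finite_sigma].
Qed.

Lemma mem_runs n r : (r \in runs n) = (size r == n) && (0 < weight sigma r).
Proof.
elim: n r => [|n IH] r /=.
  rewrite inE; case: r => [|a r] //=; by rewrite /weight /= ltr01.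
apply/allpairsPdep/idP => [[r1 [st [r1E stE ->]]]|].
  move: r1E; rewrite IH => /andP[/eqP <- w0].
  rewrite size_rcons eqxx /= weight_rcons mulr_gt0// -mem_steps//.
  exact: weight_is_run.
case/lastP: r => [//|r st]; rewrite size_rcons eqSS => /andP[sr w0].
have rr := weight_is_run w0; have /is_run_rcons[rr' _] := rr.
move: w0; rewrite weight_rcons mulr_ge0_gt0 ?weight_ge0 ?sprob_ge0// => /andP[wr s0].
by exists r, st; split=> //; rewrite ?IH ?sr ?mem_steps.
Qed.

Lemma runs_is_run n r : r \in runs n -> is_run r.
Proof. by rewrite mem_runs => /andP[_ /weight_is_run]. Qed.

Lemma runs_uniq n : uniq (runs n).
Proof.
elim: n => //= n IH; apply: allpairs_uniq_dep => //.
  by move=> r /runs_is_run; exact: steps_uniq.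
by move=> [r st] [r' st'] _ _ /= /rcons_inj[-> ->].
Qed.

Lemma sum_runsS n (f : seq (step T) -> R) :
  \sum_(r <- runs n.+1) weight sigma r * f r =
  \sum_(r <- runs n) weight sigma r *
    \sum_(st <- steps r) sprob r st * f (rcons r st).
Proof.
rewrite /= big_allpairs_dep/=; apply: eq_bigr => r _.
by rewrite big_distrr/=; apply: eq_bigr => st _; rewrite weight_rcons mulrA.
Qed.

Lemma runs_sum1 n : \sum_(r <- runs n) weight sigma r = 1.
Proof.
elim: n => [|n IH]; first by rewrite /= big_seq1.
under eq_bigr do rewrite -[weight _ _]mulr1.
rewrite (sum_runsS n (fun=> 1)) -[RHS]IH [LHS]big_seq [RHS]big_seq.
apply: eq_bigr => r /runs_is_run rr; under eq_bigr do rewrite mulr1.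
by rewrite steps_sum1// mulr1.
Qed.

End Runs.

(** * Probabilities of prefix events and of reachability *)

Section PrefixEvents.
Variables (R : realType) (T : pts R).

Lemma take_prefix_of (w : nat -> step T) m n : (m <= n)%N ->
  take m (prefix_of w n) = prefix_of w m.
Proof.
by move=> mn; rewrite /prefix_of /mkseq -map_take take_iota (minn_idPl mn).
Qed.

Lemma measurable_prefix n (A : set (seq (step T))) :
  measurable ([set w | A (prefix_of w n)] : set (run_space T)).
Proof. by apply: sub_sigma_algebra; exists n, A. Qed.

Definition hits (S : set (state T)) (r : seq (step T)) : Prop :=
  exists2 m, (m <= size r)%N & S (last_state (take m r)).

Lemma hits_prefix S w n : hits S (prefix_of w n) <->
  exists2 m, (m <= n)%N & S (last_state (prefix_of w m)).
Proof.
by split=> -[m]; rewrite ?size_mkseq => mn; [rewrite take_prefix_of//|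
  rewrite -(take_prefix_of w mn)] => Sm; exists m; rewrite ?size_mkseq.
Qed.

Section Induced.
Variables (sigma : strategy T) (P : probability (run_space T) R).
Hypothesis sS : is_strategy sigma.
Hypothesis FS : forall t : trans T, Delta t -> finite_set (supp t.2).
Hypothesis iP : induces sigma P.

Lemma prefix_in_list n (l : seq (seq (step T))) : uniq l ->
  {in l, forall r, size r = n} ->
  P [set w | prefix_of w n \in l] = (\sum_(r <- l) weight sigma r)%:E.
Proof.
elim: l => [_ _|r l IH /= /andP[rl ul] sl].
  by rewrite big_nil (_ : [set _ | _] = set0) ?measure0//; apply/seteqP; split.
have -> : [set w | prefix_of w n \in r :: l] =
    [set w : run_space T | prefix_of w n = r] `|` [set w | prefix_of w n \in l].
  apply/seteqP; split=> w /=; rewrite inE; first by case/orP => [/eqP|]; [left|right].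
  by case=> [->|->]; rewrite ?eqxx ?orbT.
rewrite measureU; last 3 first.
- exact: (measurable_prefix n [set r]).
- exact: (measurable_prefix n [set` l]).
- by apply/seteqP; split=> // w /= [->]; rewrite (negbTE rl).
rewrite big_cons EFinD; congr (_ + _)%E.
  by rewrite -(sl r) ?inE ?eqxx//; exact: iP.
by apply: IH => // s sl'; apply: sl; rewrite inE sl' orbT.
Qed.

Lemma prefix_mass_ge n (A : set (seq (step T))) :
  ((\sum_(r <- runs sigma n | `[<A r>]) weight sigma r)%:E <=
   P [set w | A (prefix_of w n)])%E.
Proof.
rewrite -big_filter -(@prefix_in_list n).
- apply: le_measure; rewrite ?in_setE.
  + exact: (measurable_prefix n [set` [seq r <- runs sigma n | `[<A r>]]]).
  + exact: measurable_prefix.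
  by move=> w /=; rewrite mem_filter => /andP[/asboolP].
- by rewrite filter_uniq// runs_uniq.
- by move=> r; rewrite mem_filter mem_runs// => /andP[_ /andP[/eqP]].
Qed.

(** [A] may be uncountable, so additivity over the listed runs gives only a lower bound. The same
    bound for the complement, together with total weight 1, gives the converse. *)
Lemma prefix_mass n (A : set (seq (step T))) :
  P [set w | A (prefix_of w n)] =
  (\sum_(r <- runs sigma n | `[<A r>]) weight sigma r)%:E.
Proof.
apply/le_anti; rewrite prefix_mass_ge andbT.
have -> : [set w : run_space T | A (prefix_of w n)] =
    ~` [set w : run_space T | (~` A) (prefix_of w n)].
  by apply/seteqP; split=> w /=; [move=> ? []|move/contrapT].
rewrite probability_setC; last exact: (measurable_prefix n (~` A)).
have -> : \sum_(r <- runs sigma n | `[<A r>]) weight sigma r =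
    1 - \sum_(r <- runs sigma n | `[<(~` A) r>]) weight sigma r.
  apply/eqP; rewrite -subr_eq opprK -(runs_sum1 sS FS n).
  rewrite [eqbRHS](bigID (fun r => `[<A r>]))/=.
  by under [X in _ + X == _]eq_bigl do rewrite /= asbool_neg.
by rewrite EFinB leeB// prefix_mass_ge.
Qed.

Lemma infinite_runE : [set w : run_space T | infinite_run w] =
  \bigcap_n [set w | is_run (prefix_of w n)].
Proof. by apply/seteqP; split=> [w h n _|w h n]; [exact: h|exact: (h n I)]. Qed.

Lemma infinite_run_ae : P (~` [set w : run_space T | infinite_run w]) = 0.
Proof.
rewrite infinite_runE setC_bigcap.
apply/eqP; rewrite eq_le measure_ge0 andbT.
apply: (@le_trans _ _ (\sum_(n <oo) P (~` [set w : run_space T | is_run (prefix_of w n)]))%E).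
  apply: measure_sigma_subadditive => //.
  - by move=> n; apply: measurableC; exact: measurable_prefix.
  - by apply: bigcup_measurable => n _; apply: measurableC; exact: measurable_prefix.
rewrite eseries0// => n _ _.
rewrite probability_setC; last exact: measurable_prefix.
rewrite prefix_mass (_ : \sum_(_ <- _ | _) _ = 1) ?subee//.
rewrite -(runs_sum1 sS FS n) big_mkcond/= big_seq [RHS]big_seq.
apply: eq_bigr => r /runs_is_run rr; by rewrite asboolT//; exact: rr.
Qed.

Lemma measurable_infinite_run : measurable [set w : run_space T | infinite_run w].
Proof.
rewrite infinite_runE; apply: bigcap_measurable => [|n _]; first by exists 0%N.
exact: measurable_prefix.
Qed.

(** Continuity from below for the increasing events of hitting [S] within [n] steps; the requirement
    in [reach] that the word be an infinite run costs only a null set. *)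
Lemma reach_cvg (S : set (state T)) :
  ((\sum_(r <- runs sigma n | `[<hits S r>]) weight sigma r)%:E @[n --> \oo] -->
  P (reach S))%E.
Proof.
pose H n := [set w : run_space T | hits S (prefix_of w n)].
have mH n : measurable (H n) by exact: measurable_prefix.
have mU : measurable (\bigcup_n H n) by exact: bigcupT_measurable.
have -> : P (reach S) = P (\bigcup_n H n).
  have -> : reach S = (\bigcup_n H n) `&` [set w | infinite_run w].
    apply/seteqP; split=> w /=.
      case=> iw [n Sn]; split=> //; exists n => //.
      by apply/hits_prefix; exists n.
    by case=> -[n _ /hits_prefix[m _ Sm]] iw; split=> //; exists m.
  rewrite [RHS](measureDI P _ measurable_infinite_run)//.
  rewrite [X in (X + _)%E](_ : _ = 0) ?add0e//.
  apply: (@subset_measure0 _ _ _ P _ (~` [set w : run_space T | infinite_run w])).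
  - by apply: measurableD => //; exact: measurable_infinite_run.
  - by apply: measurableC; exact: measurable_infinite_run.
  - by move=> w [].
  - exact: infinite_run_ae.
under eq_fun do rewrite -prefix_mass.
apply: (@nondecreasing_cvg_mu _ _ _ P H) => // m n mn.
apply/subsetPset => w /hits_prefix[i im Si]; apply/hits_prefix; exists i => //.
exact: leq_trans mn.
Qed.

End Induced.
End PrefixEvents.

(** * Existence of an induced measure *)

Section CumulativeSums.
Variables (R : realDomainType) (A : eqType) (g : A -> R).

(** Left endpoint of the interval of [x] when consecutive intervals of lengths [g y] are laid out
    from 0 in the order of [s]. *)
Definition cum (s : seq A) (x : A) : R := \sum_(y <- take (index x s) s) g y.

Lemma cum_cons y s x : x != y -> cum (y :: s) x = g y + cum s x.
Proof. by move=> xy; rewrite /cum /= eq_sym (negbTE xy) /= big_cons. Qed.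

Lemma cum_head y s : cum (y :: s) y = 0.
Proof. by rewrite /cum /= eqxx big_nil. Qed.

Hypothesis g0 : forall x, 0 <= g x.

Lemma cum_ge0 s x : 0 <= cum s x.
Proof. by rewrite sumr_ge0. Qed.

Lemma cumD_le s x : x \in s -> cum s x + g x <= \sum_(y <- s) g y.
Proof.
elim: s => // y s IH; rewrite inE; have [->|xy] := eqVneq x y.
  by rewrite cum_head add0r big_cons lerDl sumr_ge0.
by move=> /= /IH h; rewrite cum_cons// big_cons -addrA lerD2l.
Qed.

Lemma cum_split s u : uniq s -> 0 <= u < \sum_(y <- s) g y ->
  exists2 x, x \in s & cum s x <= u < cum s x + g x.
Proof.
elim: s u => [|y s IH] u; first by rewrite big_nil leNgt andNb.
rewrite big_cons /= => /andP[ys us] /andP[u0 uS]; have [uy|uy] := ltP u (g y).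
  by exists y; rewrite ?inE ?eqxx// cum_head add0r u0.
have [//||x xs xu] := IH (u - g y); first by rewrite subr_ge0 uy ltrBlDl.
have xy : x != y by apply: contraNneq ys => <-.
by exists x; rewrite ?inE ?xs ?orbT// cum_cons// -addrA -lerBrDl -ltrBlDl.
Qed.

Lemma cum_inj s u x y : x \in s -> y \in s ->
  cum s x <= u < cum s x + g x -> cum s y <= u < cum s y + g y -> x = y.
Proof.
elim: s u => // z s IH u; rewrite !inE.
have [->|xz] := eqVneq x z; have [->|yz] := eqVneq y z => //=.
- rewrite cum_head cum_cons// add0r => _ _ /andP[_ uz] /andP[zu _].
  by move: (le_lt_trans zu uz); rewrite gtrDl ltNge cum_ge0.
- rewrite cum_head cum_cons// add0r => _ _ /andP[zu _] /andP[_ uz].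
  by move: (le_lt_trans zu uz); rewrite gtrDl ltNge cum_ge0.
have E a b : (g z + a <= u < g z + a + b) = (a <= u - g z < a + b).
  by rewrite lerBrDl ltrBlDl addrA.
by rewrite !cum_cons// !E; exact: IH.
Qed.
End CumulativeSums.

Section UnitInterval.
Variable R : realType.

Let mI : measurable (`[0, 1[%classic : set R).
Proof. exact: measurable_itv. Qed.

Definition unit_law := mrestr (@lebesgue_measure R) mI.

HB.instance Definition _ := Measure.copy unit_law (mrestr (@lebesgue_measure R) mI).

Let unit_law_setT : unit_law setT = 1%E.
Proof.
by rewrite /unit_law /mrestr setTI lebesgue_measure_itv/= lte_fin ltr01 oppr0 adde0.
Qed.

HB.instance Definition _ := @Measure_isProbability.Build _ _ R
  unit_law unit_law_setT.

End UnitInterval.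

Section Existence.
Variables (R : realType) (T : pts R) (sigma : strategy T).
Hypothesis sS : is_strategy sigma.
Hypothesis FS : forall t : trans T, Delta t -> finite_set (supp t.2).
Implicit Types (r : seq (step T)) (u : R).

(** The fold carries the run read so far next to the left endpoint, since the length of the current
    cell and its subdivision both depend on that run. *)
Let lo_step (hs : seq (step T) * R) (st : step T) : seq (step T) * R :=
  (rcons hs.1 st, hs.2 + weight sigma hs.1 * cum (sprob sigma hs.1) (steps sigma hs.1) st).

Definition lo r : R := (foldl lo_step ([::], 0) r).2.

Lemma lo_rcons r st : lo (rcons r st) =
  lo r + weight sigma r * cum (sprob sigma r) (steps sigma r) st.
Proof.
rewrite /lo foldl_rcons /=; suff -> : (foldl lo_step ([::], 0) r).1 = r by [].
by elim/last_ind: r => // r a IH; rewrite foldl_rcons /= IH.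
Qed.

Definition cell r : set R := `[lo r, lo r + weight sigma r[%classic.

Lemma cellE r u : cell r u <-> lo r <= u < lo r + weight sigma r.
Proof. by rewrite /cell /= in_itv. Qed.

Lemma cell_rcons r st u : 0 < weight sigma r ->
  cell (rcons r st) u <->
  cum (sprob sigma r) (steps sigma r) st <= (u - lo r) / weight sigma r <
  cum (sprob sigma r) (steps sigma r) st + sprob sigma r st.
Proof.
move=> w0; rewrite cellE lo_rcons weight_rcons -addrA -mulrDr.
by rewrite ler_pdivlMr// ltr_pdivrMr// !(mulrC (weight _ _)) lerBrDl ltrBlDl.
Qed.

Lemma cellP r u : 0 < weight sigma r ->
  cell r u <-> 0 <= (u - lo r) / weight sigma r < 1.
Proof.
move=> w0; rewrite cellE ler_pdivlMr// ltr_pdivrMr// mul0r mul1r.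
by rewrite subr_ge0 ltrBlDl.
Qed.

Lemma cell_sub n r st u : r \in runs sigma n -> st \in steps sigma r ->
  cell (rcons r st) u -> cell r u.
Proof.
move=> rn srt; have rr := runs_is_run sS FS rn.
move: rn; rewrite mem_runs// => /andP[_ w0] /(cell_rcons _ _ w0) /andP[h1 h2].
apply/cellP => //; rewrite (le_trans _ h1) ?cum_ge0//=; last by move=> *; exact: sprob_ge0.
rewrite (lt_le_trans h2)// -(steps_sum1 sS FS rr) cumD_le//.
by move=> *; exact: sprob_ge0.
Qed.

Definition next_step r u : step T :=
  xget (point, point_dist R (init T), init T)
    [set st | st \in steps sigma r /\ cell (rcons r st) u].

Lemma next_stepP n r u : r \in runs sigma n -> cell r u ->
  next_step r u \in steps sigma r /\ cell (rcons r (next_step r u)) u.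
Proof.
move=> rn; have rr := runs_is_run sS FS rn.
move: rn; rewrite mem_runs// => /andP[_ w0] /(cellP _ w0) h.
rewrite -(steps_sum1 sS FS rr) in h.
have [x xs /(cell_rcons _ _ w0) xu] := cum_split (steps_uniq sS rr) h.
by rewrite /next_step; case: xgetP => [y -> []//|/(_ x)[]].
Qed.

Lemma next_step_uniq n r u st : r \in runs sigma n -> st \in steps sigma r ->
  cell (rcons r st) u -> next_step r u = st.
Proof.
move=> rn ss cu; have cr := cell_sub rn ss cu.
have [] := next_stepP rn cr.
move: (rn); rewrite mem_runs// => /andP[_ w0] ns /(cell_rcons _ _ w0).
move/(cell_rcons _ _ w0): cu => h1 h2; apply: cum_inj h2 h1 => //.
by move=> *; exact: sprob_ge0.
Qed.

Fixpoint path_of u n : seq (step T) :=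
  if n is m.+1 then rcons (path_of u m) (next_step (path_of u m) u) else [::].

Definition word_of u : step_seq T := fun n => next_step (path_of u n) u.

Lemma prefix_word u n : prefix_of (word_of u) n = path_of u n.
Proof. by elim: n => // n IH; rewrite /prefix_of mkseqS -/(prefix_of _ _) IH. Qed.

Lemma path_of_runs u n : 0 <= u < 1 ->
  path_of u n \in runs sigma n /\ cell (path_of u n) u.
Proof.
move=> u01; elim: n => [|n [IH1 IH2]].
  by rewrite inE; split=> //; apply/cellE; rewrite /lo /weight /= add0r.
have [h1 h2] := next_stepP IH1 IH2; split=> //=.
by apply/allpairsPdep; exists (path_of u n), (next_step (path_of u n) u).
Qed.

Lemma path_of_uniq u n r : r \in runs sigma n -> cell r u -> path_of u n = r.
Proof.
elim: n r => [|n IH] r; first by rewrite inE => /eqP ->.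
move=> /allpairsPdep[r' [st [rn ss ->]]] cu /=.
have e := IH _ rn (cell_sub rn ss cu).
by rewrite e (next_step_uniq rn ss cu).
Qed.

Lemma runs_cell n r u : r \in runs sigma n -> cell r u -> 0 <= u < 1.
Proof.
elim: n r => [|n IH] r.
  by rewrite inE => /eqP -> /cellE; rewrite /lo /weight /= add0r.
by move=> /allpairsPdep[r' [st [rn ss ->]]] /(cell_sub rn ss); exact: IH.
Qed.

(** Outside [[0, 1[], a null set for [unit_law], a constant word makes the map total and keeps it
    measurable. *)
Definition word u : run_space T :=
  if 0 <= u < 1 then word_of u else (point : step_seq T).

Lemma measurable_cells (l : seq (seq (step T))) :
  measurable [set u | exists2 r, r \in l & cell r u].
Proof.
elim: l => [|r l IH].
  by rewrite (_ : [set u | _] = set0)//; apply/seteqP; split=> // u [].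
rewrite (_ : [set u | _] = cell r `|` [set u | exists2 r, r \in l & cell r u]).
  by apply: measurableU => //; exact: measurable_itv.
apply/seteqP; split=> u /=.
  by move=> [s]; rewrite inE => /orP[/eqP ->|]; [left|right; exists s].
by case=> [cu|[s sl cu]]; [exists r|exists s]; rewrite ?inE ?eqxx ?sl ?orbT.
Qed.

(** It suffices to test the generating cylinders. Only finitely many runs of a given length own a
    cell, so a preimage is a finite union of half-open intervals, up to the points outside [[0,
    1[]. *)
Lemma measurable_word : measurable_fun setT (word : measurableTypeR R -> run_space T).
Proof.
apply: (@measurability _ _ _ (run_space T) setT word (@cylinders R T)) => //.
move=> _ [_ [n [A ->]] <-]; rewrite setTI.
pose B := if `[< A (prefix_of (point : step_seq T) n) >] then ~` `[0, 1[%classic else set0 : set R.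
rewrite (_ : _ @^-1` _ =
    [set u | exists2 r, r \in [seq r <- runs sigma n | `[<A r>]] & cell r u] `|` B).
  apply: measurableU; first exact: measurable_cells.
  by rewrite /B; case: ifP => // _; apply: measurableC; exact: measurable_itv.
apply/seteqP; split=> u /=.
  rewrite /word; case: ifPn => u01.
    rewrite prefix_word => Au; left; have [h1 h2] := path_of_runs n u01.
    by exists (path_of u n) => //; rewrite mem_filter h1 andbT; apply/asboolP.
  by move=> Ap; right; rewrite /B asboolT//= in_itv/=; exact/negP.
case=> [[r]|].
  rewrite mem_filter => /andP[/asboolP Ar rn cu].
  by rewrite /word (runs_cell rn cu) prefix_word (path_of_uniq rn cu).
rewrite /B; case: asboolP => //= Ap; rewrite in_itv/= => /negP u01.
by rewrite /word (negbTE u01).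
Qed.

Lemma induces_exists : exists P : probability (run_space T) R, induces sigma P.
Proof.
pose X : {mfun measurableTypeR R >-> run_space T} :=
  HB.pack word (isMeasurableFun.Build _ _ (measurableTypeR R) (run_space T) word measurable_word).
exists (distribution (@unit_law R) X) => r.
have E (B : set (measurableTypeR R)) :
    (forall u, B u <-> prefix_of (word u) (size r) = r /\ 0 <= u < 1) ->
    distribution (@unit_law R) X [set w | prefix_of w (size r) = r] =
    lebesgue_measure B.
  move=> HB; congr (lebesgue_measure _); apply/seteqP.
  by split=> u /=; rewrite in_itv/= => /HB.
have [rn|rn] := boolP (r \in runs sigma (size r)).
  transitivity (lebesgue_measure (cell r : set (measurableTypeR R))); last first.
    rewrite lebesgue_measure_itv/= lte_fin ltrDl.
    move: rn; rewrite mem_runs// => /andP[_ ->].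
    by rewrite -EFinD addrAC subrr add0r.
  apply: E.
  move=> u; split=> [cu|[+ u01]].
    have u01 := runs_cell rn cu; split=> //.
    by rewrite /word u01 prefix_word; exact: path_of_uniq.
  rewrite /word u01 prefix_word => {1}<-.
  by have [] := path_of_runs (size r) u01.
(* A sequence outside the enumeration, be it a run or not, has weight 0 and is a prefix of no word
   that comes from [[0, 1[]. *)
have -> : weight sigma r = 0.
  apply/le_anti; rewrite weight_ge0 andbT leNgt.
  by move: rn; rewrite mem_runs// eqxx.
transitivity (lebesgue_measure (set0 : set (measurableTypeR R))); last exact: measure0.
apply: E => u; split=> // -[+ u01].
rewrite /word u01 prefix_word => ru; have [] := path_of_runs (size r) u01.
by rewrite ru (negbTE rn).
Qed.

End Existence.

(** * Simulations *)

Section Push.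
Variables (R : realType) (Q1 Q2 : choiceType) (h : Q1 -> Q2).
Implicit Types mu : Dist R Q1.

Definition push mu (q : Q2) : R := \sum_(s <- enumD mu | h s == q) mu s.

Lemma push_ge0 mu q : 0 <= push mu q.
Proof. by rewrite sumr_ge0// => s _; exact: dist_ge0. Qed.

Lemma push_ge mu s : finite_set (supp mu) -> mu s <= push mu (h s).
Proof.
move=> fm; have [s0|] := ltP 0 (mu s); last by move=> /le_trans; apply; exact: push_ge0.
rewrite /push big_mkcond (bigD1_seq s) ?enumD_uniq//= ?mem_enumD// eqxx lerDl.
by rewrite sumr_ge0// => i _; case: ifP => // _; exact: dist_ge0.
Qed.

Lemma push_wmass mu (l : seq (R * Q1)) q : {in l, forall z, 0 <= z.1} ->
  (forall s, mu s = wmass l s) -> push mu q = wmass [seq (z.1, h z.2) | z <- l] q.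
Proof.
move=> l0 ml; rewrite /push /wmass big_map /=.
rewrite big_mkcond [RHS]big_mkcond /=.
transitivity (\sum_(s <- enumD mu) mu s * (h s == q)%:R).
  by apply: eq_bigr => s _; case: eqP; rewrite ?mulr1 ?mulr0.
rewrite (sum_enumD _ l0 ml).
by apply: eq_bigr => s _; case: eqP; rewrite ?mulr1 ?mulr0.
Qed.
End Push.

Lemma wmassE (R : realType) (Q : choiceType) (l : seq (R * Q)) q :
  wmass l q = \sum_(z <- l) z.1 * (z.2 == q)%:R.
Proof.
rewrite /wmass big_mkcond; apply: eq_bigr => z _.
by case: eqP; rewrite ?mulr1 ?mulr0.
Qed.

Section Simulation.
Variables (R : realType) (T1 T2 : pts R) (h : state T1 -> state T2).

(* A randomised choice between transitions of T2 whose overall effect is the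
   image under h of the effect of t. *)
Definition lifts (t : trans T1) (l : seq (R * trans T2)) : Prop :=
  [/\ {in l, forall z, 0 <= z.1}, \sum_(z <- l) z.1 = 1,
      {in l, forall z, z.2.1.1 = h t.1.1} &
      forall s2, \sum_(z <- l) z.1 * z.2.2 s2 = push h t.2 s2].

Variables (D1 E1 : set (trans T1)) (D2 E2 : set (trans T2)).
Hypothesis Delta1 : forall t : trans T1, Delta t -> D1 t \/ E1 t.
Hypothesis Delta2 : forall t : trans T2, D2 t \/ E2 t -> Delta t.
Hypothesis disj1 : forall t, D1 t -> E1 t -> False.
Hypothesis disj2 : forall t, D2 t -> E2 t -> False.
Hypothesis FS1 : forall t : trans T1, Delta t -> finite_set (supp t.2).
Hypothesis FS2 : forall t : trans T2, Delta t -> finite_set (supp t.2).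
Hypothesis live2 : forall r : seq (step T2), is_run r ->
  exists t : trans T2, Delta t /\ t.1.1 = last_state r.
Hypothesis h_init : h (init T1) = init T2.
Hypothesis liftD : forall t, D1 t ->
  exists l, lifts t l /\ {in l, forall z, D2 z.2}.
Hypothesis liftE : forall t, E1 t ->
  exists l, lifts t l /\ {in l, forall z, E2 z.2}.

(** Disjointness of [D1] and [E1] lets one list per transition serve both clauses, one of them
    vacuously. *)
Lemma lift_choice : exists lam : trans T1 -> seq (R * trans T2),
  forall t, Delta t -> [/\ lifts t (lam t),
    D1 t -> {in lam t, forall z, D2 z.2} & E1 t -> {in lam t, forall z, E2 z.2}].
Proof.
have H t : exists l, Delta t -> [/\ lifts t l,
    D1 t -> {in l, forall z, D2 z.2} & E1 t -> {in l, forall z, E2 z.2}].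
  have [dt|ndt] := pselect (Delta t); last by exists [::].
  have [d|e] := Delta1 dt.
    by have [l [? ?]] := liftD d; exists l => _; split=> // /(disj1 d).
  by have [l [? ?]] := liftE e; exists l => _; split=> // /disj1/(_ e).
by exists (fun t => projT1 (cid (H t))) => t; case: (cid (H t)).
Qed.

Section Strategy.
Variables (sigma : strategy T1) (lam : trans T1 -> seq (R * trans T2)).
Hypothesis sS : is_strategy sigma.
Hypothesis lamP : forall t, Delta t -> [/\ lifts t (lam t),
    D1 t -> {in lam t, forall z, D2 z.2} & E1 t -> {in lam t, forall z, E2 z.2}].
Implicit Types (r : seq (step T2)) (rho : seq (step T1)).

(* Conditional on the move st2 of T2, the successor of T1 is drawn from the
   states lying over that of st2; the division makes this a probability. *)
Definition joint_step rho (st1 : step T1) (st2 : step T2) : R :=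
  sprob sigma rho st1 *
  (wmass (lam (trans_after rho st1)) (h (last_state rho), st2.1.1, st2.1.2) *
   st2.1.2 st2.2 * (h st1.2 == st2.2)%:R / push h st1.1.2 st2.2).

Let extend (L : seq (R * seq (step T1))) (st2 : step T2) :=
  [seq (z.1 * joint_step z.2 st1 st2, rcons z.2 st1) | z <- L, st1 <- steps sigma z.2].

(* The runs of T1 that may accompany the run r of T2, with the joint weights. *)
Definition joint r : seq (R * seq (step T1)) := foldl extend [:: (1, [::])] r.

Lemma joint_rcons r st2 : joint (rcons r st2) =
  [seq (z.1 * joint_step z.2 st1 st2, rcons z.2 st1) |
     z <- joint r, st1 <- steps sigma z.2].
Proof. by rewrite /joint foldl_rcons. Qed.

Lemma lam_ge0 t : Delta t -> {in lam t, forall z, 0 <= z.1}.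
Proof. by move=> /lamP[[]]. Qed.

Lemma joint_step_ge0 rho st1 st2 : is_run rho -> st1 \in steps sigma rho ->
  0 <= joint_step rho st1 st2.
Proof.
move=> rr; rewrite (mem_steps sS FS1 _ rr) => s0.
have /is_run_rcons[_ [Dt _]] : is_run (rcons rho st1).
  apply/is_run_rcons; split=> //; move: s0; rewrite sprob_gt0 => /andP[t0 m0].
  by split=> //; have [] := sigma_Delta sS rr t0.
rewrite /joint_step mulr_ge0 ?sprob_ge0// !mulr_ge0 ?dist_ge0 ?ler0n ?invr_ge0 ?push_ge0//.
exact/wmass_ge0/lam_ge0.
Qed.

(** The indicator in [joint_step] annihilates every source step whose end does not lie over the
    target state, so positive joint weight makes the two runs match state by state. *)
Lemma jointP r z : z \in joint r ->
  [/\ 0 <= z.1, z.2 \in runs sigma (size r) &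
      0 < z.1 -> forall m, (m <= size r)%N ->
        h (last_state (take m z.2)) = last_state (take m r)].
Proof.
elim/last_ind: r z => [|r st2 IH] z.
  by rewrite inE => /eqP -> /=; split=> // _ [|].
rewrite joint_rcons => /allpairsPdep[y [st1 [/IH[y0 yr yh] s1 ->]]] /=.
have rr := runs_is_run sS FS1 yr.
have q0 := joint_step_ge0 st2 rr s1.
have sy : size y.2 = size r by move: yr; rewrite (mem_runs sS FS1) => /andP[/eqP].
split.
- exact: mulr_ge0.
- by rewrite size_rcons; apply/allpairsPdep; exists y.2, st1.
- move=> yq m; rewrite size_rcons leq_eqVlt => /predU1P[->|].
    rewrite !take_oversize ?size_rcons ?sy// !last_state_rcons.
    apply/eqP; apply: contraTT yq => /negbTE hs.
    by rewrite /joint_step hs mulr0 mul0r !mulr0 ltxx.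
  rewrite ltnS => mr; rewrite -!cats1 !takel_cat ?sy//; apply: yh => //.
  rewrite lt_neqAle y0 andbT eq_sym; apply: contraTneq yq => ->.
  by rewrite mul0r ltxx.
Qed.

Lemma joint_last r z : z \in joint r -> 0 < z.1 -> h (last_state z.2) = last_state r.
Proof.
move=> /jointP[_ zr zh] /zh /(_ _ (leqnn _)).
by move: zr; rewrite (mem_runs sS FS1) => /andP[/eqP {1}<- _]; rewrite !take_size.
Qed.

Definition jmass r : R := \sum_(z <- joint r) z.1.

Lemma jmass_ge0 r : 0 <= jmass r.
Proof. by rewrite /jmass big_seq sumr_ge0// => z /jointP[]. Qed.

Lemma jmass_eq0 r z : jmass r = 0 -> z \in joint r -> z.1 = 0.
Proof.
move=> /eqP; rewrite /jmass big_seq psumr_eq0; last by move=> y /jointP[].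
by move=> /allP H zr; have := H _ zr; rewrite zr => /eqP.
Qed.

(** [z.1 / jmass r] is the posterior probability of the source run [z.2] given [r]; the other
    factors are the choice of [sigma] and that of a lifted transition. *)
Definition mix_list r : seq (R * trans T2) :=
  [seq (zt.1.1 * sigma zt.1.2 zt.2 * y.1 / jmass r, y.2) |
     zt <- [seq (z, t) | z <- joint r, t <- enumD (sigma z.2)], y <- lam zt.2].

Lemma sum_mix_list r (f : trans T2 -> R) :
  \sum_(x <- mix_list r) x.1 * f x.2 =
  (\sum_(z <- joint r) z.1 * \sum_(t <- enumD (sigma z.2)) sigma z.2 t *
     \sum_(y <- lam t) y.1 * f y.2) / jmass r.
Proof.
rewrite /mix_list !big_allpairs_dep/= mulr_suml; apply: eq_bigr => z _.
rewrite mulr_sumr mulr_suml; apply: eq_bigr => t _.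
rewrite !mulr_sumr mulr_suml; apply: eq_bigr => y _.
by rewrite /=; ring.
Qed.

Lemma joint_Delta r z t : z \in joint r -> t \in enumD (sigma z.2) ->
  [/\ Delta t, t.1.1 = last_state z.2 & 0 < sigma z.2 t].
Proof.
move=> /jointP[_ /(runs_is_run sS FS1) rr _].
rewrite (mem_enumD _ (finite_sigma sS rr)) => t0.
by have [] := sigma_Delta sS rr t0.
Qed.

Lemma mix_listP r x : x \in mix_list r -> exists z t y,
  [/\ z \in joint r, t \in enumD (sigma z.2), y \in lam t &
      x = (z.1 * sigma z.2 t * y.1 / jmass r, y.2)].
Proof.
move=> /allpairsPdep[_ [y [/allpairsPdep[z [t [zr tz ->]]] yt ->]]].
by exists z, t, y.
Qed.

Lemma mix_list_ge0 r : {in mix_list r, forall x, 0 <= x.1}.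
Proof.
move=> x /mix_listP[z [t [y [zr tz yt ->]]]] /=.
have [Dt _ s0] := joint_Delta zr tz.
rewrite !mulr_ge0 ?invr_ge0 ?jmass_ge0 ?dist_ge0//; last exact: lam_ge0 yt.
by have [] := jointP zr.
Qed.

Lemma mix_list_sum1 r : 0 < jmass r -> \sum_(x <- mix_list r) x.1 = 1.
Proof.
move=> W0; under eq_bigr do rewrite -[_.1]mulr1.
rewrite (sum_mix_list r (fun=> 1)); apply: (canLR (mulfK _)); first by rewrite gt_eqF.
rewrite mul1r /jmass [LHS]big_seq [RHS]big_seq; apply: eq_bigr => z zr.
rewrite -[RHS]mulr1; congr (_ * _).
have [_ /(runs_is_run sS FS1) rr _] := jointP zr.
rewrite -[RHS](enumD_sum1 (finite_sigma sS rr)) [LHS]big_seq [RHS]big_seq.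
apply: eq_bigr => t tz; have [Dt _ _] := joint_Delta zr tz.
rewrite -[RHS]mulr1; congr (_ * _).
have [[_ l1 _ _] _ _] := lamP Dt; rewrite -[RHS]l1.
by apply: eq_bigr => y _; rewrite mulr1.
Qed.

(** A target run of joint mass 0 has no source run to imitate, yet a strategy must answer on every
    run; [live2] provides a legal transition. *)
Definition default_trans r : trans T2 :=
  xget (init T2, point, point_dist R (init T2))
    [set t | Delta t /\ t.1.1 = last_state r].

(* The expected reply of sigma, given that the run of T2 is r. *)
Definition mixed : strategy T2 := fun r =>
  if pselect (0 < jmass r) is left W0
  then wdist (@mix_list_ge0 r) (mix_list_sum1 W0)
  else point_dist R (default_trans r).

Lemma mixedE r t : 0 < jmass r -> mixed r t = wmass (mix_list r) t.
Proof. by move=> W0; rewrite /mixed; case: pselect. Qed.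

Lemma mixed_gt0P r t : 0 < jmass r -> 0 < mixed r t -> exists z t1 y,
  [/\ z \in joint r, t1 \in enumD (sigma z.2), y \in lam t1,
      y.2 = t & [/\ 0 < z.1, 0 < y.1, Delta t1, 0 < sigma z.2 t1 &
        t.1.1 = last_state r]].
Proof.
move=> W0; rewrite mixedE// => /(wmass_gt0P (@mix_list_ge0 r))[x xr [<-]].
have [z [t1 [y [zr tz yt ->]]]] := mix_listP xr; rewrite /=.
have [Dt tl s0] := joint_Delta zr tz; have [z0 _ _] := jointP zr.
have y0 := lam_ge0 Dt yt.
rewrite pmulr_lgt0 ?invr_gt0// => p0.
have z0' : 0 < z.1.
  by rewrite lt_neqAle z0 andbT eq_sym; apply: contraTneq p0 => ->; rewrite !mul0r ltxx.
have y0' : 0 < y.1.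
  by rewrite lt_neqAle y0 andbT eq_sym; apply: contraTneq p0 => ->; rewrite mulr0 ltxx.
exists z, t1, y; split=> //; split=> //.
by have [[_ _ -> // _] _ _] := lamP Dt; rewrite tl; exact: joint_last.
Qed.

Lemma lam_Delta t y : Delta t -> y \in lam t -> Delta y.2.
Proof.
move=> Dt yt; apply: Delta2; have [_ HD HE] := lamP Dt.
by have [/HD|/HE] := Delta1 Dt; [left|right]; auto.
Qed.

Lemma mixed_strategy : is_strategy mixed.
Proof.
move=> r rr; have [W0|W0] := pselect (0 < jmass r).
  split.
    by apply: (finite_supp_wmass (@mix_list_ge0 r)) => q; exact: mixedE.
  move=> t /(mixed_gt0P W0)[z [t1 [y [zr tz yt <- [_ _ Dt _ e]]]]].
  by split=> //; exact: lam_Delta yt.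
rewrite /mixed; case: pselect => // _; rewrite /supp /=; split.
  apply: (@sub_finite_set _ _ [set default_trans r]); last exact: finite_set1.
  by move=> t /=; case: eqP => //; rewrite ltxx.
move=> t /=; case: eqP => [-> _|]; last by rewrite ltxx.
rewrite /default_trans; case: xgetP => [_ -> //|/(_ _) N].
by have [t0 [? ?]] := live2 rr; case: (N t0).
Qed.

(** Given the target state [s2], the draw from its fibre has total probability 1. Where the fibre
    has mass 0 the quotient is 0 by convention, so [c] has to vanish there. *)
Lemma push_sum (t : trans T1) (c : R) (s2 : state T2) : Delta t ->
  (push h t.2 s2 = 0 -> c = 0) ->
  \sum_(s <- enumD t.2) t.2 s * (c * (h s == s2)%:R / push h t.2 s2) = c.
Proof.
move=> Dt c0; have [p0|p0] := eqVneq (push h t.2 s2) 0.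
  by rewrite (c0 p0) big1// => s _; rewrite !mul0r mulr0.
transitivity (c / push h t.2 s2 * push h t.2 s2); last by rewrite divfK.
rewrite [in X in _ = _ * X]/push [in RHS]big_mkcond mulr_sumr; apply: eq_bigr => s _.
by case: eqP => _ /=; ring.
Qed.

(** The weights in [lam t] are nonnegative and the mixture is the image of [t], so no summand
    charges a state that the image does not charge. This is the side condition of [push_sum]. *)
Lemma lam_push t (t2 : trans T2) s2 : Delta t -> push h t.2 s2 = 0 ->
  wmass (lam t) t2 * t2.2 s2 = 0.
Proof.
move=> Dt p0; apply/le_anti/andP; split; last first.
  by rewrite mulr_ge0 ?dist_ge0//; exact/wmass_ge0/lam_ge0.
have [[l0 _ _ lp] _ _] := lamP Dt.
rewrite -p0 -lp wmassE mulr_suml big_seq [leRHS]big_seq ler_sum// => y yt.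
by case: eqP => [->|_]; rewrite ?mulr1 ?mulr0 ?mul0r ?mulr_ge0 ?dist_ge0 ?l0.
Qed.

Lemma jmass_rcons r st2 : jmass (rcons r st2) =
  (\sum_(z <- joint r) z.1 * \sum_(t <- enumD (sigma z.2))
    sigma z.2 t * wmass (lam t) (trans_after r st2)) * st2.1.2 st2.2.
Proof.
rewrite /jmass joint_rcons big_allpairs_dep/= mulr_suml [LHS]big_seq [RHS]big_seq.
apply: eq_bigr => z zr; have [z0 zrun _] := jointP zr.
have rr := runs_is_run sS FS1 zrun.
rewrite -mulr_sumr -mulrA.
have [->|zn0] := eqVneq z.1 0; first by rewrite !mul0r.
have hz : h (last_state z.2) = last_state r.
  by apply: (joint_last zr); rewrite lt_neqAle eq_sym zn0.
congr (_ * _); rewrite /joint_step (sum_steps sS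
  (fun st1 => wmass (lam (trans_after z.2 st1)) (h (last_state z.2), st2.1.1, st2.1.2) *
   st2.1.2 st2.2 * (h st1.2 == st2.2)%:R / push h st1.1.2 st2.2) rr).
rewrite mulr_suml [LHS]big_seq [RHS]big_seq.
apply: eq_bigr => t tz; have [Dt tl s0] := joint_Delta zr tz.
rewrite -mulrA; congr (_ * _).
under eq_bigr do rewrite /= trans_eta//.
rewrite push_sum// ?hz// => p0.
exact: (@lam_push t (last_state r, st2.1.1, st2.1.2)).
Qed.

(** First marginal of the joint weights: the denominator [jmass r] of the conditional choice cancels
    against the weight of [r]. If that mass is 0, both sides vanish whatever the default answer
    is. *)
Lemma weight_mixed r : weight mixed r = jmass r.
Proof.
elim/last_ind: r => [|r st2 IH]; first by rewrite /weight /jmass /joint /= big_seq1.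
rewrite weight_rcons IH jmass_rcons /sprob mulrA; congr (_ * _).
have [W0|W0] := ltP 0 (jmass r).
  rewrite mixedE// wmassE (sum_mix_list r (fun t => (t == trans_after r st2)%:R)).
  rewrite mulrC divfK ?gt_eqF//; apply: eq_bigr => z _; congr (_ * _).
  by apply: eq_bigr => t _; rewrite wmassE.
have W00 : jmass r = 0 by apply/le_anti; rewrite W0 jmass_ge0.
rewrite W00 mul0r big_seq big1// => z zr.
by rewrite (jmass_eq0 W00 zr) mul0r.
Qed.

(** For a fixed source step, summing the lifted choices over the target transitions yields the image
    of [st1.1.2] at [h st1.2], which the denominator in [joint_step] divides away. *)
Lemma joint_step_sum r z st1 : r \in runs mixed (size r) -> z \in joint r ->
  0 < z.1 -> st1 \in steps sigma z.2 ->
  \sum_(st2 <- steps mixed r) joint_step z.2 st1 st2 = sprob sigma z.2 st1.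
Proof.
move=> rn zr z0 s1; have rr := runs_is_run mixed_strategy FS2 rn.
have W0 : 0 < jmass r.
  by move: rn; rewrite (mem_runs mixed_strategy FS2) weight_mixed => /andP[].
have [_ /(runs_is_run sS FS1) zrr _] := jointP zr.
rewrite -mulr_sumr -[RHS]mulr1; congr (_ * _).
have sp0 : 0 < sprob sigma z.2 st1 by rewrite -(mem_steps sS FS1 _ zrr).
set t := trans_after z.2 st1.
have /andP[t0 m0] : (0 < sigma z.2 t) && (0 < st1.1.2 st1.2) by rewrite -sprob_gt0.
have [Dt tl] := sigma_Delta sS zrr t0.
have tz : t \in enumD (sigma z.2) by rewrite (mem_enumD _ (finite_sigma sS zrr)).
have p0 : 0 < push h st1.1.2 (h st1.2).
  by apply: lt_le_trans m0 _; apply: push_ge; exact: (FS1 Dt).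
have hz := joint_last zr z0.
rewrite /steps big_allpairs_dep/=.
pose f (t2 : trans T2) := t2.2 (h st1.2) / push h st1.1.2 (h st1.2).
transitivity (\sum_(t2 <- enumD (mixed r)) wmass (lam t) t2 * f t2).
  rewrite [LHS]big_seq [RHS]big_seq; apply: eq_bigr => t2 t2r.
  have t20 : 0 < mixed r t2.
    by rewrite -(mem_enumD _ (finite_sigma mixed_strategy rr)).
  have [Dt2 t2l] := sigma_Delta mixed_strategy rr t20.
  have -> : (h (last_state z.2), t2.1.2, t2.2) = t2.
    by rewrite hz -t2l; case: (t2) => -[].
  have F2 := FS2 Dt2.
  transitivity (\sum_(s <- enumD t2.2)
      t2.2 s * (wmass (lam t) t2 * (h st1.2 == s)%:R / push h st1.1.2 s)).
    by apply: eq_bigr => s _; ring.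
  rewrite /f; have [hs|hs] := boolP (h st1.2 \in enumD t2.2).
    rewrite (bigD1_seq (h st1.2)) ?enumD_uniq//= eqxx big1 => [|s sh].
      by rewrite addr0 (_ : true%:R = 1)// mulr1; ring.
    by rewrite eq_sym (negbTE sh) mulr0 mul0r mulr0.
  rewrite big_seq big1 => [|s sE]; last first.
    have /negbTE-> : h st1.2 != s by apply: contraNneq hs => ->.
    by rewrite mulr0 mul0r mulr0.
  move: hs; rewrite mem_enumD// -leNgt => hs.
  have -> : t2.2 (h st1.2) = 0 by apply/le_anti; rewrite hs dist_ge0.
  by rewrite mul0r mulr0.
have [[l0 _ _ lp] _ _] := lamP Dt.
(* Since [z] and [t] have positive weight, every transition of nonzero weight in [lam t] is in the
   support of [mixed r]; restricting the sum to that support loses nothing. *)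
rewrite (@wmass_sum _ _ _ (lam t)) ?enumD_uniq//; last first.
  move=> y yt yn0; rewrite (mem_enumD _ (finite_sigma mixed_strategy rr)).
  rewrite mixedE//.
  pose x := (z.1 * sigma z.2 t * y.1 / jmass r, y.2).
  apply: (@wmass_gt0 _ _ (mix_list r) x).
  - exact: mix_list_ge0.
  - apply/allpairsPdep; exists (z, t), y; split=> //.
    by apply/allpairsPdep; exists z, t.
  - by rewrite /x/= divr_gt0// !mulr_gt0// lt_neqAle eq_sym yn0 l0.
rewrite /f; under eq_bigr do rewrite mulrA.
by rewrite -mulr_suml lp divff// gt_eqF.
Qed.

(* The second marginal of the joint weights. *)
Lemma sum_joint n (G : seq (step T1) -> R) :
  \sum_(r <- runs mixed n) \sum_(z <- joint r) z.1 * G z.2 =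
  \sum_(rho <- runs sigma n) weight sigma rho * G rho.
Proof.
elim: n G => [|n IH] G; first by rewrite /= /joint !big_seq1 /weight.
rewrite sum_runsS -IH /= big_allpairs_dep/= [LHS]big_seq [RHS]big_seq.
apply: eq_bigr => r rn.
have rs : r \in runs mixed (size r).
  by move: rn; rewrite !(mem_runs mixed_strategy FS2) eqxx => /andP[].
under eq_bigr do rewrite joint_rcons big_allpairs_dep/=.
rewrite exchange_big/= [LHS]big_seq [RHS]big_seq; apply: eq_bigr => z zr.
rewrite exchange_big/= mulr_sumr [LHS]big_seq [RHS]big_seq; apply: eq_bigr => st1 s1.
have [z0 _ _] := jointP zr.
have [z00|z00] := eqVneq z.1 0.
  by rewrite z00 big1 ?mul0r// => *; rewrite !mul0r.
rewrite -(joint_step_sum rs zr _ s1); last by rewrite lt_neqAle eq_sym z00.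
by rewrite mulr_suml mulr_sumr; apply: eq_bigr => *; ring.
Qed.

Variables (S1 : set (state T1)) (S2 : set (state T2)).
Hypothesis S12 : forall s, S1 s <-> S2 (h s).

(** Both sides are expectations of an indicator under the joint weights, and paired runs of positive
    joint weight hit [S1] and [S2] together. *)
Lemma hits_mass n :
  \sum_(r <- runs mixed n | `[<hits S2 r>]) weight mixed r =
  \sum_(rho <- runs sigma n | `[<hits S1 rho>]) weight sigma rho.
Proof.
transitivity (\sum_(rho <- runs sigma n) weight sigma rho * (`[<hits S1 rho>])%:R).
  rewrite -sum_joint big_mkcond/= [LHS]big_seq [RHS]big_seq.
  apply: eq_bigr => r rn; rewrite weight_mixed /jmass.
  transitivity (\sum_(z <- joint r) z.1 * (`[<hits S2 r>])%:R).
    by rewrite -mulr_suml; case: asbool; rewrite ?mulr1 ?mulr0.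
  rewrite [LHS]big_seq [RHS]big_seq; apply: eq_bigr => z zr.
  have [z0 zrun zh] := jointP zr.
  have [->|z00] := eqVneq z.1 0; first by rewrite !mul0r.
  have {}z0 : 0 < z.1 by rewrite lt_neqAle eq_sym z00.
  have sz : size z.2 = size r by move: zrun; rewrite (mem_runs sS FS1) => /andP[/eqP].
  congr (_ * (nat_of_bool _)%:R); apply/asbool_equiv_eq.
  by split=> -[m mr Sm]; exists m; rewrite ?sz// -?sz//; move: Sm;
    rewrite S12 zh// -?sz.
by rewrite [RHS]big_mkcond; apply: eq_bigr => rho _; case: asbool; rewrite ?mulr1 ?mulr0.
Qed.

Hypothesis sA : alternating_strategies D1 E1 sigma.

(** The averaged source runs might prescribe different kinds of next transition. By [disj2] the kind
    of the last target transition determines that of the last source transition, and alternation of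
    [sigma] then fixes the next kind for all of them alike. *)
Lemma mixed_alternating : alternating_strategies D2 E2 mixed.
Proof.
split; first exact: mixed_strategy.
move=> r st rr; rewrite weight_mixed => W0.
have key z : z \in joint (rcons r st) -> 0 < z.1 ->
    exists t, [/\ Delta t, exists2 y, y \in lam t & y.2 = trans_after r st &
      (D1 t /\ supp (sigma z.2) `<=` E1) \/ (E1 t /\ supp (sigma z.2) `<=` D1)].
  move=> zr z0; have [_ zrun _] := jointP zr.
  have zrr := runs_is_run sS FS1 zrun.
  move: (zrun); rewrite (mem_runs sS FS1) => /andP[_ zw].
  move: zr; rewrite joint_rcons => /allpairsPdep[y [st1 [yr s1 e]]].
  have [_ /= sA2] := sA; move: z0 zrr zw; rewrite e /= => z0 zrr zw.
  have [y0 _ _] := jointP yr.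
  have y0' : 0 < y.1.
    by rewrite lt_neqAle y0 andbT eq_sym; apply: contraTneq z0 => ->; rewrite mul0r ltxx.
  have /is_run_rcons[_ [Dt _]] := zrr.
  exists (trans_after y.2 st1); split=> //; last exact: sA2.
  have : 0 < wmass (lam (trans_after y.2 st1)) (trans_after r st).
    rewrite lt_neqAle wmass_ge0 ?andbT; last exact: lam_ge0.
    rewrite eq_sym; apply: contraTneq z0.
    rewrite /joint_step (joint_last yr y0') => ->.
    by rewrite !mul0r !mulr0 ltxx.
  by move=> /(wmass_gt0P (lam_ge0 Dt))[x xt [? _]]; exists x.
have next t2 : mixed (rcons r st) t2 > 0 -> exists z t y,
    [/\ z \in joint (rcons r st), 0 < z.1, supp (sigma z.2) t, Delta t & y \in lam t /\ y.2 = t2].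
  move=> /(mixed_gt0P W0)[z [t1 [y [zr tz yt yE [z0 _ Dt s0 _]]]]].
  by exists z, t1, y.
have [z zr z0] : exists2 z, z \in joint (rcons r st) & 0 < z.1.
  apply: contrapT => N; move: W0; rewrite /jmass big_seq big1 ?ltxx// => z zr.
  apply/eqP; have [z0 _ _] := jointP zr; apply: contrapT => /negP zn0.
  by apply: N; exists z => //; rewrite lt_neqAle eq_sym zn0.
have [t [Dt [y yt yE] alt]] := key z zr z0.
have [_ lD lE] := lamP Dt.
have aux (b : D2 (trans_after r st) \/ E2 (trans_after r st)) z' :
    z' \in joint (rcons r st) -> 0 < z'.1 ->
    (D2 (trans_after r st) -> supp (sigma z'.2) `<=` E1) /\
    (E2 (trans_after r st) -> supp (sigma z'.2) `<=` D1).
  move=> zr' z0'; have [t' [Dt' [y' yt' yE'] alt']] := key z' zr' z0'.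
  have [_ lD' lE'] := lamP Dt'.
  split=> d2; case: alt' => -[d1 ss] //.
    by exfalso; apply: (disj2 d2); rewrite -yE'; exact: lE'.
  by exfalso; apply: (@disj2 (trans_after r st)) => //; rewrite -yE'; exact: lD'.
case: alt => -[d1 _].
  have d2 : D2 (trans_after r st) by rewrite -yE; exact: lD.
  left; split=> // t2 /next[z' [t' [y' [zr' z0' st' Dt' [yt' <-]]]]].
  have [_ _ lE'] := lamP Dt'; apply: lE' => //.
  by have [/(_ d2) + _] := aux (or_introl d2) _ zr' z0'; exact.
have e2 : E2 (trans_after r st) by rewrite -yE; exact: lE.
right; split=> // t2 /next[z' [t' [y' [zr' z0' st' Dt' [yt' <-]]]]].
have [_ lD' _] := lamP Dt'; apply: lD' => //.
by have [_ /(_ e2)] := aux (or_intror e2) _ zr' z0'; exact.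
Qed.

End Strategy.

Lemma simulation_reach_values (S1 : set (state T1)) (S2 : set (state T2)) :
  (forall s, S1 s <-> S2 (h s)) ->
  reach_values (alternating_strategies D1 E1) S1 `<=`
  reach_values (alternating_strategies D2 E2) S2.
Proof.
move=> S12 _ [sigma [P [sA iP ->]]]; have [sS _] := sA.
have [lam lamP] := lift_choice.
pose tau := mixed sS lamP.
have tS : is_strategy tau by exact: mixed_strategy.
have [P' iP'] := induces_exists tS FS2.
exists tau, P'; split => //; first exact: mixed_alternating.
have c1 := @reach_cvg _ _ _ _ sS FS1 iP S1.
have c2 := @reach_cvg _ _ _ _ tS FS2 iP' S2.
(* Both reachability probabilities are limits of one and the same sequence of finite-horizon
   sums. *)
move: c1; under eq_fun do rewrite -(hits_mass sS lamP S12); move=> c1.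
exact: (cvg_unique (@ereal_hausdorff R) c1 c2).
Qed.

End Simulation.

(** * Regions *)

Section RegionBlocks.
Variables (X : finType) (k M : nat).
Implicit Types r : region X k M.

Lemma parts_gt0 r : (0 < size (reg_parts r))%N.
Proof. by have /and5P[] := reg_ok r; case: (reg_parts r). Qed.

Lemma block_lt r x : (block r x < size (reg_parts r))%N.
Proof.
rewrite /block -has_find; have /and5P[_ _ _ /eqP cov _] := reg_ok r.
have : x \in [set: X]%SET by rewrite inE.
rewrite -cov; elim: (reg_parts r) => [|A s IH]; first by rewrite big_nil inE.
by rewrite big_cons inE /= => /orP[->//|/IH ->]; rewrite orbT.
Qed.

Lemma mem_block r x : x \in nth finset.set0 (reg_parts r) (block r x).
Proof.
have h : has (fun A : {set X} => x \in A) (reg_parts r) by rewrite has_find block_lt.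
exact: (nth_find finset.set0 h).
Qed.

Lemma mem_part r i x : (i < size (reg_parts r))%N ->
  (x \in nth finset.set0 (reg_parts r) i) = (block r x == i).
Proof.
move=> ir; apply/idP/eqP => [xi|<-]; last exact: mem_block.
apply/eqP; case: ltngtP => // [bi|ib].
  have /and5P[_ _ /(pairwiseP finset.set0) disj _ _] := reg_ok r.
  have := disj _ _ (block_lt r x) ir bi; rewrite /= => /eqP/setP/(_ x).
  by rewrite !inE xi andbT mem_block.
by have := before_find finset.set0 ib; rewrite xi.
Qed.

Lemma block_surj r i : (0 < i < size (reg_parts r))%N -> exists x, block r x = i.
Proof.
case: i => // i /= ir; have /and5P[_ n0 _ _ _] := reg_ok r.
have /set0Pn[x] : nth finset.set0 (reg_parts r) i.+1 != finset.set0.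
  apply: contraNneq n0 => <-; rewrite -nth_behead mem_nth// size_behead.
  by case: (reg_parts r) ir.
by rewrite mem_part// => /eqP; exists x.
Qed.

Lemma block_max r x : reg_h r x = (k * M)%N :> nat -> block r x = 0%N.
Proof.
move=> hx; have /and5P[_ _ _ _ /forallP/(_ x)] := reg_ok r.
by rewrite hx eqxx /= -nth0 mem_part ?parts_gt0// => /eqP.
Qed.

(** Only the first part may be empty, so every positive index below the length is attained and the
    block indices determine the number of parts. *)
Lemma region_eq r r' : (forall x, reg_h r x = reg_h r' x) ->
  (forall x, block r x = block r' x) -> r = r'.
Proof.
move=> hh hb.
have le r1 r2 : (forall x, block r1 x = block r2 x) ->
    (size (reg_parts r1) <= size (reg_parts r2))%N.
  move=> hb'; rewrite leqNgt; apply/negP => lt12.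
  have [|x xb] := @block_surj r1 (size (reg_parts r2)).
    by rewrite parts_gt0.
  by have := block_lt r2 x; rewrite -hb' xb ltnn.
have sz : size (reg_parts r) = size (reg_parts r').
  by apply/eqP; rewrite eqn_leq !le.
have eh : reg_h r = reg_h r' by apply/ffunP.
have ep : reg_parts r = reg_parts r'.
  apply: (@eq_from_nth _ finset.set0) => // i ir; apply/setP => x.
  by rewrite !mem_part -?sz// hb.
move: eh ep; clear; case: r => h p ok; case: r' => h' p' ok' /= eh ep.
by move: ok ok'; rewrite eh ep => ok ok'; rewrite (bool_irrelevance ok ok').
Qed.
End RegionBlocks.

(** * Valuations and the regions that contain them *)

Section InRegion.
Variables (R : realType) (X : finType) (k M : nat).
Hypothesis k0 : (0 < k)%N.
Implicit Types (r : region X k M) (u v : valuation R X) (x y : X).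

Let kR0 : (0 : R) < k%:R. Proof. by rewrite ltr0n. Qed.

(* The distance from the lower corner, in units of 1/k. *)
Definition off r v x : R := k%:R * (v x)%:num - (reg_h r x)%:R.

Lemma off_eq0 r v x : off r v x = 0 <-> v x = hval R r x.
Proof.
split=> [/eqP|e].
  rewrite /off subr_eq0 => /eqP e; apply: val_inj => /=.
  by rewrite -e mulrC mulKf// gt_eqF.
by rewrite /off e /hval /= mulrC divfK ?subrr// gt_eqF.
Qed.

Lemma in_regionE r v : in_region v r <->
  [/\ forall x, 0 <= off r v x < 1,
      forall x, off r v x = 0 <-> block r x = 0%N &
      forall x y, off r v x <= off r v y <-> (block r x <= block r y)%N].
Proof.
have fE x : Num.floor (k%:R * (v x)%:num) = (reg_h r x)%:Z <-> 0 <= off r v x < 1.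
  rewrite /off subr_ge0 ltrBlDl; split=> [e|/andP[h1 h2]].
    have := floor_itv (k%:R * (v x)%:num); by rewrite e intrD mulr1z -!pmulrn.
  by apply: floor_def; rewrite intrD mulr1z -!pmulrn h1 h2.
split=> -[H1 H2 H3]; split.
- by move=> x; apply/fE.
- by move=> x; rewrite off_eq0.
- by move=> x y; rewrite -H3 /kfrac !H1.
- by move=> x; apply/fE.
- by move=> x; rewrite -off_eq0.
- by move=> x y; rewrite -H3 /kfrac !(iffRL (fE _)).
Qed.

Lemma kfracE r v x : in_region v r -> kfrac k v x = off r v x.
Proof. by move=> -[e _ _]; rewrite /kfrac e. Qed.

(** Classical region equivalence: integer parts, vanishing fractions and the order of fractions. It
    moves membership between valuations without handling partitions. *)
Lemma same_region r u v : in_region v r ->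
  (forall x, Num.floor (k%:R * (u x)%:num) = Num.floor (k%:R * (v x)%:num)) ->
  (forall x, kfrac k u x = 0 <-> kfrac k v x = 0) ->
  (forall x y, kfrac k u x <= kfrac k u y <-> kfrac k v x <= kfrac k v y) ->
  in_region u r.
Proof.
move=> vr hf h0 hle; have [e1 e2 e3] := vr; split.
- by move=> x; rewrite hf.
- move=> x; rewrite -e2 -!off_eq0 -(kfracE _ vr) -h0.
  by rewrite /kfrac hf e1.
- by move=> x y; rewrite hle.
Qed.

Lemma region_same r u v : in_region u r -> in_region v r ->
  [/\ forall x, Num.floor (k%:R * (u x)%:num) = Num.floor (k%:R * (v x)%:num),
  forall x, kfrac k u x = 0 <-> kfrac k v x = 0 &
  forall x y, kfrac k u x <= kfrac k u y <-> kfrac k v x <= kfrac k v y].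
Proof.
move=> ur vr; have [e1 e2 e3] := ur; have [f1 f2 f3] := vr; split.
- by move=> x; rewrite e1 f1.
- move=> x; rewrite (kfracE _ ur) (kfracE _ vr).
  by move/in_regionE : ur => [_ -> _]; move/in_regionE : vr => [_ -> _].
- by move=> x y; rewrite e3 f3.
Qed.

(** The fractions give only the zero block and the weak order of the clocks. Indices follow because
    all positive ones are attained: by induction, a clock of index [i] in one region has index at
    least [i] in the other. *)
Lemma in_region_inj v r r' : in_region v r -> in_region v r' -> r = r'.
Proof.
have le r1 r2 : in_region v r1 -> in_region v r2 ->
    forall i x, block r1 x = i -> (i <= block r2 x)%N.
  move=> vr1 vr2; have [_ _ e3] := vr1; have [_ _ f3] := vr2.
  have b0 x : block r2 x = 0%N -> block r1 x = 0%N.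
    move=> h; have /in_regionE[_ e2 _] := vr1; have /in_regionE[_ f2 _] := vr2.
    by apply/e2; rewrite -(kfracE x vr1) (kfracE x vr2); apply/f2.
  (* Index 1 needs its own argument: block 0 may be empty, so there may be no lower clock to compare
     with. *)
  elim=> // i IH x xi; case: i IH xi => [_ xi|i IH xi].
    by rewrite lt0n; apply/eqP => /b0; rewrite xi.
  have [|y yi] := @block_surj _ _ _ r1 i.+1.
    by rewrite /=; apply: leq_ltn_trans (block_lt r1 x); rewrite xi.
  apply: leq_ltn_trans (IH _ yi) _; rewrite ltnNge; apply/negP => /f3/e3.
  by rewrite xi yi ltnn.
move=> vr vr'; apply: region_eq => x.
  by apply: val_inj; case: vr => /(_ x) + _ _; case: vr' => /(_ x) -> _ _ [].
by apply/eqP; rewrite eqn_leq (le r r') ?(le r' r).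
Qed.

Lemma le_nat_in_region v r x (c : nat) : in_region v r ->
  (c%:R <= (v x)%:num) = (k * c <= reg_h r x)%N.
Proof.
move=> /in_regionE[h _ _]; have := h x; rewrite /off subr_ge0 ltrBlDl => /andP[h1 h2].
rewrite -(ler_pM2l kR0) -natrM; apply/idP/idP => [c1|c1].
  by have := le_lt_trans c1 h2; rewrite natr1 ltr_nat ltnS.
by apply: le_trans h1; rewrite ler_nat.
Qed.

Lemma lt_nat_in_region v r x (c : nat) : in_region v r ->
  (c%:R < (v x)%:num) =
  (k * c < reg_h r x)%N || ((k * c == reg_h r x)%N && (block r x != 0%N)).
Proof.
move=> vr; rewrite lt_neqAle (le_nat_in_region x c vr) leq_eqVlt.
have -> : (c%:R == (v x)%:num) = (k%:R * (v x)%:num == (k * c)%:R).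
  by rewrite natrM (inj_eq (mulfI (lt0r_neq0 kR0))) eq_sym.
have [e|ne] := eqVneq (k * c)%N (nat_of_ord (reg_h r x)).
  rewrite e ltnn /= andbT -subr_eq0 -/(off r v x).
  move/in_regionE : vr => [_ h0 _]; congr (~~ _).
  by apply/eqP/eqP => /h0.
rewrite /= orbF; apply: andb_idl => lt; apply/eqP => e.
move/in_regionE : vr => [/(_ x) + _ _].
by rewrite /off e subr_ge0 ler_nat leqNgt lt.
Qed.

Lemma sat_in_region u v r psi : in_region u r -> in_region v r -> sat u psi = sat v psi.
Proof.
move=> ur vr; apply: eq_all => -[[x op] c] /=; case: op.
- by rewrite !ltNge (le_nat_in_region x c ur) (le_nat_in_region x c vr).
- by rewrite !leNgt (lt_nat_in_region x c ur) (lt_nat_in_region x c vr).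
- by rewrite (le_nat_in_region x c ur) (le_nat_in_region x c vr).
- by rewrite (lt_nat_in_region x c ur) (lt_nat_in_region x c vr).
Qed.

(** Pieces have natural-number endpoints, and comparison with these does not separate points of one
    region, whatever the granularity. *)
Lemma piece_dom_in_region u v r q x : in_region u r -> in_region v r ->
  piece_dom q (u x)%:num -> piece_dom q (v x)%:num.
Proof.
move=> ur vr.
have L c : (c%:R <= (u x)%:num) = (c%:R <= (v x)%:num).
  by rewrite (le_nat_in_region _ _ ur) (le_nat_in_region _ _ vr).
have S c : (c%:R < (u x)%:num) = (c%:R < (v x)%:num).
  by rewrite (lt_nat_in_region _ _ ur) (lt_nat_in_region _ _ vr).
have L' c : ((u x)%:num <= c%:R) = ((v x)%:num <= c%:R) by rewrite !leNgt S.
have S' c : ((u x)%:num < c%:R) = ((v x)%:num < c%:R) by rewrite !ltNge L.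
by case: q => -[[[[] a|[]] [[] b|[]]] c d]; rewrite /piece_dom /= !in_itv /=
  ?L ?S ?L' ?S'.
Qed.

Lemma reset_in_region u v r r' (Y : {set X}) : in_region u r -> in_region v r ->
  in_region (reset v Y) r' -> in_region (reset u Y) r'.
Proof.
move=> ur vr vr'; have [s1 s2 s3] := region_same ur vr.
have K (w : valuation R X) x : kfrac k (reset w Y) x = if x \in Y then 0 else kfrac k w x.
  by rewrite /kfrac ffunE; case: ifP => // _ /=; rewrite mulr0 floor0 subr0.
have K0 (w : valuation R X) (r1 : region X k M) x : in_region w r1 -> 0 <= kfrac k w x.
  by move=> wr; rewrite (kfracE _ wr); move/in_regionE : wr => [/(_ x)/andP[]].
apply: same_region vr' _ _ _.
- by move=> x; rewrite !ffunE; case: ifP.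
- by move=> x; rewrite !K; case: ifP.
- move=> x y; rewrite !K; case: ifP => _; case: ifP => _ //.
    by rewrite (K0 _ _ _ ur) (K0 _ _ _ vr).
  split=> h.
    by rewrite (iffLR (s2 x))//; apply/le_anti; rewrite h (K0 _ _ _ ur).
  by rewrite (iffRL (s2 x))//; apply/le_anti; rewrite h (K0 _ _ _ vr).
Qed.

Lemma in_region_nonempty r : exists v, in_region v r.
Proof.
have p0 : (0 : R) < (size (reg_parts r))%:R by rewrite ltr0n parts_gt0.
have nn x : (0 : R) <= ((reg_h r x)%:R + (block r x)%:R / (size (reg_parts r))%:R) / k%:R.
  by rewrite divr_ge0// addr_ge0// divr_ge0.
(* The offset of a clock is its block index over the number of parts: below 1, zero exactly in block
   0, and ordered as the blocks are. *)
exists [ffun x => NngNum (nn x)]; apply/in_regionE.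
have o x : off r [ffun x => NngNum (nn x)] x = (block r x)%:R / (size (reg_parts r))%:R.
  by rewrite /off ffunE /= mulrC divfK ?gt_eqF// addrC addKr.
split.
- by move=> x; rewrite o divr_ge0//= ltr_pdivrMr// mul1r ltr_nat block_lt.
- move=> x; rewrite o; split=> [/eqP|->]; last by rewrite mul0r.
  by rewrite mulf_eq0 invr_eq0 (gt_eqF p0) orbF pnatr_eq0 => /eqP.
- by move=> x y; rewrite !o ler_pM2r ?invr_gt0// ler_nat.
Qed.

Lemma in_region_bound v r x : in_region v r -> (v x)%:num <= M%:R.
Proof.
move=> vr; rewrite -(ler_pM2l kR0) -natrM.
have [e|ne] := eqVneq (nat_of_ord (reg_h r x)) (k * M)%N.
  move/in_regionE : vr => [_ /(_ x) [_ /(_ (block_max e))] /eqP + _].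
  by rewrite /off subr_eq0 e => /eqP ->.
move/in_regionE : vr => [/(_ x) /andP[_ +] _ _]; rewrite /off ltrBlDl => /ltW h.
apply: le_trans h _; rewrite natr1 ler_nat ltn_neqAle ne.
by rewrite -ltnS ltn_ord.
Qed.

Lemma region_exists v : (forall x, (v x)%:num <= M%:R) -> exists r, in_region v r.
Proof.
move=> vM.
(* Adjoining 0 makes index 0 the class of vanishing fractions even when no clock belongs to it; the
   first part is then empty. *)
pose s := sort <=%O (undup (0 :: [seq kfrac k v x | x <- enum X])).
have us : sorted <%O s by rewrite sort_lt_sorted undup_uniq.
have ms e : (e \in s) = (e == 0) || (e \in [seq kfrac k v x | x <- enum X]).
  by rewrite mem_sort mem_undup inE.
have xs x : kfrac k v x \in s by rewrite ms map_f ?mem_enum// orbT.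
have kf0 x : 0 <= kfrac k v x.
  by rewrite /kfrac subr_ge0; have /andP[] := floor_itv (k%:R * (v x)%:num).
have s0 e : e \in s -> 0 <= e.
  by rewrite ms => /orP[/eqP->//|/mapP[x _ ->]].
have z : 0 \in s by rewrite ms eqxx.
have ss : (0 < size s)%N by case: (s) z.
have n0 : nth 0 s 0 = 0.
  apply/le_anti; rewrite s0 ?mem_nth// andbT.
  rewrite -[leRHS](nth_index 0 z).
  by rewrite (lt_sorted_leq_nth 0 us) ?inE ?index_mem.
pose parts := [seq [set x | kfrac k v x == e]%SET | e <- s].
have tI x : (Num.truncn (k%:R * (v x)%:num))%:R <= k%:R * (v x)%:num <
    (Num.truncn (k%:R * (v x)%:num)).+1%:R.
  by apply: truncn_itv; rewrite mulr_ge0.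
have hM x : (Num.truncn (k%:R * (v x)%:num) < (k * M).+1)%N.
  rewrite ltnS -(ler_nat R); have /andP[h _] := tI x.
  by apply: le_trans h _; rewrite natrM ler_wpM2l.
pose h := [ffun x => Ordinal (hM x)].
have fh x : Num.floor (k%:R * (v x)%:num) = (h x)%:Z.
  have /andP[h1 h2] := tI x.
  by apply: floor_def; rewrite ffunE /= intrD mulr1z -!pmulrn h1 natr1.
have bE x : find (fun A : {set X} => x \in A) parts = index (kfrac k v x) s.
  by rewrite /parts find_map; apply: eq_find => e; rewrite /= inE eq_sym.
have ok : region_ok h parts.
  apply/and5P; split.
  - by rewrite -size_eq0 size_map -lt0n.
  - apply/negP; rewrite /parts behead_map => /mapP[e es /esym/setP e0].
    move: us n0 ms es; case: (s) => // a s' us /= a0 ms es.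
    have : e \in a :: s' by rewrite inE es orbT.
    rewrite ms => /orP[/eqP e00|/mapP[x _ ex]].
      move: us => /lt_sorted_uniq /= /andP[+ _]; by rewrite a0 -e00 es.
    by have := e0 x; rewrite !inE ex eqxx.
  - rewrite /parts pairwise_map; have := lt_sorted_uniq us; rewrite uniq_pairwise.
    apply: sub_pairwise => a b /= ab; apply/eqP/setP => x; rewrite !inE.
    by apply/negP => /andP[/eqP-> ]; exact/negP.
  - apply/eqP/setP => x; rewrite inE finset.bigcup_seq; apply/finset.bigcupP.
    exists [set y | kfrac k v y == kfrac k v x]%SET; last by rewrite inE.
    exact: map_f.
  - apply/forallP => x; apply/implyP => /eqP hx.
    rewrite -nth0 (nth_map 0)// n0 inE /kfrac fh hx subr_eq0 eq_le.
    have := floor_itv (k%:R * (v x)%:num); rewrite fh hx => /andP[-> _].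
    by rewrite andbT -pmulrn natrM ler_wpM2l.
exists (Region ok); split.
- by move=> x; rewrite fh.
- move=> x; rewrite -off_eq0 /block /= bE.
  have -> : off (Region ok) v x = kfrac k v x by rewrite /off /kfrac fh.
  split=> [->|i0]; last by rewrite -(nth_index 0 (xs x)) i0.
  move: n0; case: (s) ss => // a s' _ /= ->; by rewrite eqxx.
- move=> x y; rewrite /block /= !bE.
  rewrite -[X in X <= _](nth_index 0 (xs x)) -[X in _ <= X](nth_index 0 (xs y)).
  by rewrite (lt_sorted_leq_nth 0 us) ?inE ?index_mem.
Qed.

End InRegion.

(** An elementary passage to the limit at [t = 0]; closed conditions reach the boundary of a region
    this way. *)
Lemma segment_ge0 (R : realFieldType) (a b : R) :
  (forall t, 0 < t <= 1 -> 0 <= (1 - t) * a + t * b) -> 0 <= a.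
Proof.
move=> H; rewrite leNgt; apply/negP => a0.
have d0 : 0 < 2 * (`|b| - a) by have := normr_ge0 b; lra.
have d1 : - a <= 2 * (`|b| - a) by have := normr_ge0 b; lra.
(* At this parameter the gain over [a] is at most [- a / 2], so the affine expression is at most
   [a / 2], which is negative. *)
have := H (- a / (2 * (`|b| - a))).
rewrite divr_gt0 ?oppr_gt0// ler_pdivrMr// mul1r d1 => /(_ isT).
apply/negP; rewrite -ltNge; set t := - a / _.
have te : t * (2 * (`|b| - a)) = - a by rewrite /t divfK// gt_eqF.
have t0 : 0 <= t by rewrite /t divr_ge0 ?oppr_ge0 ?ltW.
have : t * b <= t * `|b| by rewrite ler_wpM2l// ler_norm.
lra.
Qed.

(** * Closed regions and convex combinations of corners *)

Section ClosedRegions.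
Variables (R : realType) (X : finType) (k M : nat).
Hypothesis k0 : (0 < k)%N.
Implicit Types (r : region X k M) (u v : valuation R X) (x y : X) (t : R).

Let kR0 : (0 : R) < k%:R. Proof. by rewrite ltr0n. Qed.

Definition closed_region u r : Prop :=
  [/\ forall x, 0 <= off r u x <= 1,
      forall x, block r x = 0%N -> off r u x = 0 &
      forall x y, (block r x <= block r y)%N -> off r u x <= off r u y].

Lemma in_closed_region v r : in_region v r -> closed_region v r.
Proof.
move=> /(in_regionE k0)[h1 h2 h3]; split=> [x|x /h2//|x y /h3//].
by have /andP[-> /ltW] := h1 x.
Qed.

(* For t in [0, 1] the absolute value does nothing. *)
Definition mixv t u v : valuation R X :=
  [ffun x => `|(1 - t) * (u x)%:num + t * (v x)%:num|%:nng].

Lemma mixvE t u v x : 0 < t <= 1 ->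
  (mixv t u v x)%:num = (1 - t) * (u x)%:num + t * (v x)%:num.
Proof.
move=> /andP[/ltW t0 t1]; rewrite ffunE /= ger0_norm// addr_ge0// mulr_ge0//.
by rewrite subr_ge0.
Qed.

Lemma off_mixv r t u v x : 0 < t <= 1 ->
  off r (mixv t u v) x = (1 - t) * off r u x + t * off r v x.
Proof. by move=> t01; rewrite /off mixvE//; ring. Qed.

(** The strict conditions come from [v], which has positive weight, and the weak ones satisfied by
    [u] cannot spoil them. *)
Lemma mixv_in_region r t u v : closed_region u r -> in_region v r -> 0 < t <= 1 ->
  in_region (mixv t u v) r.
Proof.
move=> [u1 u2 u3] vr t01; have vr' := vr; move: vr => /(in_regionE k0)[v1 v2 v3].
have /andP[t0 t1] := t01; have t10 : 0 <= 1 - t by rewrite subr_ge0.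
apply/(in_regionE k0); split.
- move=> x; rewrite off_mixv//; have /andP[a0 a1] := u1 x; have /andP[b0 b1] := v1 x.
  apply/andP; split; first by rewrite addr_ge0// mulr_ge0// ltW.
  have : (1 - t) * off r u x <= 1 - t by rewrite ler_piMr.
  have : t * off r v x < t by rewrite gtr_pMr.
  lra.
- move=> x; rewrite off_mixv//; split=> [e|b0]; last first.
    by rewrite (u2 _ b0) ((v2 x).2 b0) !mulr0 addr0.
  apply/v2; have /andP[a0 _] := u1 x; have /andP[b0 _] := v1 x.
  have /eqP : t * off r v x = 0.
    by apply/le_anti/andP; split; [rewrite -e lerDr mulr_ge0|rewrite mulr_ge0// ltW].
  by rewrite mulf_eq0 gt_eqF//= => /eqP.
- move=> x y; rewrite !off_mixv//; split=> [|b]; last first.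
    by apply: lerD; apply: ler_wpM2l => //; [exact: u3|exact: ltW|exact/v3].
  apply: contraTT; rewrite -ltnNge -ltNge => b.
  rewrite ler_ltD// ?ler_wpM2l ?u3 ?(ltnW b)// ltr_pM2l// ltNge.
  by apply/negP => /v3; rewrite leqNgt b.
Qed.

Lemma closed_region_lim r u v :
  (forall t, 0 < t <= 1 -> in_region (mixv t u v) r) -> closed_region u r.
Proof.
move=> H.
have H1 t : 0 < t <= 1 -> closed_region (mixv t u v) r.
  by move=> /H/in_closed_region.
have u1 x : 0 <= off r u x <= 1.
  apply/andP; split.
    apply: (@segment_ge0 _ _ (off r v x)) => t t01.
    by rewrite -off_mixv//; have [/(_ x)/andP[]] := H1 _ t01.
  rewrite -subr_ge0; apply: (@segment_ge0 _ _ (1 - off r v x)) => t t01.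
  have [/(_ x)/andP[_ +] _ _] := H1 _ t01; rewrite off_mixv//; lra.
split=> // [x b0|x y b].
  apply/le_anti; have /andP[-> _] := u1 x; rewrite andbT -oppr_ge0.
  apply: (@segment_ge0 _ _ (- off r v x)) => t t01.
  have [_ /(_ x b0) + _] := H1 _ t01; rewrite off_mixv//; lra.
rewrite -subr_ge0; apply: (@segment_ge0 _ _ (off r v y - off r v x)) => t t01.
have [_ _ /(_ x y b)] := H1 _ t01; rewrite !off_mixv//; lra.
Qed.

Lemma off_corner r i x : off r (corner R r i) x = (i < block r x)%N%:R.
Proof.
rewrite /off /corner ffunE; case: ltnP => h /=; rewrite ?mulrDr mulrC divfK ?gt_eqF//.
  by rewrite divff ?gt_eqF// addrC addKr.
by rewrite subrr.
Qed.

Lemma corner_closed r i : closed_region (corner R r i) r.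
Proof.
split.
- by move=> x; rewrite off_corner; case: ltnP; rewrite ?lexx ?ler01.
- by move=> x b; rewrite off_corner b.
- move=> x y b; rewrite !off_corner ler_nat; case: ltnP => // h.
  by rewrite (leq_trans h b).
Qed.

(* The weight of the j-th corner is the gap between the offsets of the blocks
   j and j.+1, where the offset is 1 beyond the last block. *)
Lemma corner_combination u r : closed_region u r -> exists lam : nat -> R,
  [/\ forall j, 0 <= lam j, \sum_(j < size (reg_parts r)) lam j = 1 &
      forall x, (u x)%:num =
        \sum_(j < size (reg_parts r)) lam j * (corner R r j x)%:num].
Proof.
move=> [u1 u2 u3]; set n := size (reg_parts r).
have n0 : (0 < n)%N by exact: parts_gt0.
pose F i := if (n <= i)%N then 1 else
  if [pick x | block r x == i] is Some x then off r u x else 0.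
have Fb x : F (block r x) = off r u x.
  rewrite /F leqNgt block_lt /=; case: pickP => [y /eqP b|/(_ x)]; last by rewrite eqxx.
  by apply/le_anti; rewrite !u3 ?b.
have Fn : F n = 1 by rewrite /F leqnn.
have F0 : F 0%N = 0.
  by rewrite /F leqNgt n0 /=; case: pickP => // x /eqP/u2.
have Fle j : F j <= F j.+1.
  have [nj|jn] := leqP n j.+1.
    rewrite {2}/F nj /F; case: leqP => // _.
    by case: pickP => [x _|_]; [have /andP[] := u1 x|exact: ler01].
  have [x xb] : exists x, block r x = j.+1 by apply: block_surj.
  rewrite -xb Fb; have [j0|j0] := posnP j.
    by rewrite j0 F0; have /andP[] := u1 x.
  have [y yb] : exists y, block r y = j by apply: block_surj; rewrite j0 ltnW.
  by rewrite -yb Fb; apply: u3; rewrite yb xb.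
have tele i m : (i <= m)%N -> \sum_(i <= j < m) (F j.+1 - F j) = F m - F i.
  exact: telescope_sumr.
have S1 : \sum_(j < n) (F j.+1 - F j) = 1.
  by rewrite -(big_mkord xpredT (fun j => F j.+1 - F j)) tele// Fn F0 subr0.
exists (fun j => F j.+1 - F j); split=> // [j|x]; first by rewrite subr_ge0.
have E j : (corner R r j x)%:num = ((reg_h r x)%:R + (j < block r x)%N%:R) / k%:R.
  by rewrite -off_corner /off addrC subrK mulrC mulKf// gt_eqF.
under eq_bigr do rewrite E mulrA mulrDr.
rewrite -mulr_suml big_split/= -mulr_suml S1 mul1r.
have -> : \sum_(j < n) (F j.+1 - F j) * (j < block r x)%N%:R = off r u x.
  rewrite -(big_mkord xpredT (fun j => (F j.+1 - F j) * (j < block r x)%N%:R)).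
  rewrite (big_cat_nat (n := block r x))//=; last by rewrite ltnW// block_lt.
  rewrite [X in _ + X]big_nat_cond [X in _ + X]big1 => [|j /andP[/andP[bj _] _]]; last first.
    by rewrite ltnNge bj mulr0.
  rewrite addr0 -(Fb x); transitivity (F (block r x) - F 0%N); last by rewrite F0 subr0.
  rewrite -(tele 0%N)// big_nat_cond [RHS]big_nat_cond.
  by apply: eq_bigr => j /andP[/andP[_ ->] _]; rewrite mulr1.
by rewrite /off addrC subrK mulrC mulKf// gt_eqF.
Qed.

End ClosedRegions.

(** * Piecewise linear functions on closures of pieces *)

Section ClosureValues.
Variable R : realType.
Implicit Types (q : piece) (qs : seq piece) (I : set R) (f : R -> R).

Lemma piece_dom_interval q : is_interval (piece_dom q : set R).
Proof. exact: interval_is_interval. Qed.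

Lemma piece_val_continuous q : continuous (@piece_val R q).
Proof.
move=> x; rewrite /piece_val; apply: cvgD; first exact: cvg_cst.
by apply: cvgM; [exact: cvg_cst|exact: cvg_id].
Qed.

(** Along the piece, [f] and the linear expression have the same limit at [a]; the filter is proper
    because [a] lies in the closure. *)
Lemma closure_piece_val q I f (a : R) : {within I, continuous f} ->
  piece_dom q `<=` I -> (forall c, piece_dom q c -> f c = piece_val q c) ->
  I a -> closure (piece_dom q) a -> f a = piece_val q a.
Proof.
move=> /subspace_continuousP fc qI fq Ia ca.
have PF : ProperFilter (within (piece_dom q) (nbhs a)) by exact: within_nbhs_proper.
have c1 : f x @[x --> within (piece_dom q) (nbhs a)] --> f a.
  apply: cvg_trans (fc _ Ia); apply: cvg_app; exact: within_subset.
have c2 : f x @[x --> within (piece_dom q) (nbhs a)] --> piece_val q a.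
  apply: cvg_trans; last first.
    exact: (@cvg_within_filter _ _ (@piece_val R q) (nbhs a) _
      (nbhs (piece_val q a)) (piece_dom q) (@piece_val_continuous q a)).
  by apply: fmap_within_eq => x /set_mem/fq ->.
exact: (cvg_unique (@norm_hausdorff _ _) c1 c2).
Qed.

(** Makes the piece found by [find] immaterial. If [a] is in [I], continuity gives every adjacent
    piece the value [f a]. Otherwise two distinct pieces accumulating at [a] would overlap if on the
    same side of [a], and would force [a] into the interval [I] if on opposite sides. *)
Lemma closure_valE qs I f q (a : R) : is_partition qs I -> is_interval I ->
  {within I, continuous f} ->
  (forall q c, q \in qs -> piece_dom q c -> f c = piece_val q c) ->
  q \in qs -> closure (piece_dom q) a -> closure_val qs a = piece_val q a.
Proof.
move=> [ne /trivIsetP disj cov] iI fc fq qq ca; rewrite /closure_val.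
have hq : has (fun q : piece => `[< closure (piece_dom q : set R) a >]) qs.
  by apply/hasP; exists q => //; apply/asboolP.
have /asboolP ca' := nth_find piece0 hq; move: hq; rewrite has_find.
set j := find _ _ in ca' *; move=> js.
have sub i : (i < size qs)%N -> piece_dom (nth piece0 qs i) `<=` I.
  by move=> iq z qz; rewrite -cov; exists i.
have [Ia|nIa] := pselect (I a).
  have E i : (i < size qs)%N -> closure (piece_dom (nth piece0 qs i)) a ->
      f a = piece_val (nth piece0 qs i) a.
    move=> iq ci; apply: (closure_piece_val fc) => //; first exact: sub.
    by move=> c; apply: fq; exact: mem_nth.
  by rewrite -E// -[in RHS](nth_index piece0 qq) -E ?index_mem// nth_index.
have [<-//|ji] := eqVneq (nth piece0 qs j) q.
have {}ji : j != index q qs by apply: contraNneq ji => ->; rewrite nth_index.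
have iq : (index q qs < size qs)%N by rewrite index_mem.
have := disj _ _ js iq ji; rewrite nth_index// => D.
have aj : ~ piece_dom (nth piece0 qs j) a by move=> /(sub _ js).
have aq : ~ piece_dom q a by rewrite -(nth_index piece0 qq) => /(sub _ iq).
have [b1 qb1] := ne _ js; have := ne _ iq; rewrite nth_index// => -[b2 qb2].
have subq : piece_dom q `<=` I by rewrite -(nth_index piece0 qq); exact: sub.
have side (q' : piece) b : ~ piece_dom q' a -> piece_dom q' b -> b < a ->
    forall z, piece_dom q' z -> z < a.
  move=> na qb ba z qz; rewrite ltNge; apply/negP => az; apply: na.
  by apply: (piece_dom_interval qb qz); rewrite ltW.
have side' (q' : piece) b : ~ piece_dom q' a -> piece_dom q' b -> a < b ->
    forall z, piece_dom q' z -> a < z.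
  move=> na qb ba z qz; rewrite ltNge; apply/negP => az; apply: na.
  by apply: (piece_dom_interval qz qb); rewrite az ltW.
exfalso.
have [b1a|ab1|e] := ltgtP b1 a; last by apply: aj; rewrite -e.
- have [b2a|ab2|e] := ltgtP b2 a; last by apply: aq; rewrite -e.
  (* Each piece is an interval that reaches from its own point arbitrarily close to [a], so both
     contain the larger of [b1] and [b2]. *)
  + have ma : Num.max b1 b2 < a by rewrite gt_max b1a.
    have [z1 [qz1 /= mz1]] := ca' _ (lt_nbhsr ma).
    have [z2 [qz2 /= mz2]] := ca _ (lt_nbhsr ma).
    have : (piece_dom (nth piece0 qs j) `&` piece_dom q) (Num.max b1 b2).
      split.
        by apply: (piece_dom_interval qb1 qz1); rewrite le_max lexx/= ltW.
      by apply: (piece_dom_interval qb2 qz2); rewrite le_max lexx orbT/= ltW.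
    by rewrite D.
  + by apply: nIa; apply: (iI _ _ (sub _ js _ qb1) (subq _ qb2)); rewrite !ltW.
- have [b2a|ab2|e] := ltgtP b2 a; last by apply: aq; rewrite -e.
  + by apply: nIa; apply: (iI _ _ (subq _ qb2) (sub _ js _ qb1)); rewrite !ltW.
  + have ma : a < Num.min b1 b2 by rewrite lt_min ab1.
    have [z1 [qz1 /= mz1]] := ca' _ (lt_nbhsl ma).
    have [z2 [qz2 /= mz2]] := ca _ (lt_nbhsl ma).
    have : (piece_dom (nth piece0 qs j) `&` piece_dom q) (Num.min b1 b2).
      split.
        by apply: (piece_dom_interval qz1 qb1); rewrite ge_min lexx/= ltW.
      by apply: (piece_dom_interval qz2 qb2); rewrite ge_min lexx orbT/= ltW.
    by rewrite D.
Qed.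

End ClosureValues.

(** * Corner probabilities *)

(** Each atom constrains a single clock: changing [v] at [x] alone keeps the other atoms true, and
    those on [x] hold between two admissible values. *)
Lemma clock_range_interval (R : realType) (X : finType) (g : clock_constraint X) (x : X) :
  is_interval (clock_range g x : set R).
Proof.
move=> _ _ [v /= vg <-] [w /= wg <-] z /andP[vz zw].
have z0 : 0 <= z by apply: le_trans vz.
exists [ffun y => if y == x then NngNum z0 else v y]; last by rewrite ffunE eqxx.
apply/allP => -[[y op] c] ag; have va := allP vg _ ag; have wa := allP wg _ ag.
move: va wa; rewrite /= ffunE; case: eqP => [->|_] /=; last by [].
by case: op {ag} => h1 h2; [exact: le_lt_trans h2|exact: le_trans h2|
  exact: le_trans h1 _|exact: lt_le_trans h1 _].
Qed.

Section CornerProbabilities.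
Variables (R : realType) (X L : finType) (P : cdpta R X L).
Variables (k M : nat) (p : edge R X L) (r : region X k M) (v : valuation R X).
Hypotheses (k0 : (0 < k)%N) (pp : prob P p) (vr : in_region v r).
Hypothesis (vg : sat v (guard p)).
Implicit Types (u : valuation R X) (e : {set X} * L).

Lemma in_region_guard u : in_region u r -> sat u (guard p).
Proof. by move=> ur; rewrite (sat_in_region k0 _ ur vr). Qed.

Lemma guard_piece e x : exists2 q, q \in pl_pieces P p e x & piece_dom q (v x)%:num.
Proof.
have [_ _ cov] := @pl_partition _ _ _ P p e x pp.
have : clock_range (guard p) x (v x)%:num by exists v.
by rewrite -cov => -[i /= iq qi]; exists (nth piece0 (pl_pieces P p e x) i) => //; exact: mem_nth.
Qed.

Lemma closed_region_closure u q x : closed_region u r ->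
  piece_dom q (v x)%:num -> closure (piece_dom q) (u x)%:num.
Proof.
move=> uc qv B /nbhs_ballP[eps /= e0 eB].
set a := (u x)%:num; set b := (v x)%:num.
have d0 : 0 < 2 * (`|b - a| + eps) by have := normr_ge0 (b - a); lra.
(* Chosen so that moving from [u] towards [v] by [t] shifts the clock [x] by less than [eps]. *)
pose t := eps / (2 * (`|b - a| + eps)).
have t0 : 0 < t by rewrite divr_gt0.
have t1 : t <= 1 by rewrite ler_pdivrMr// mul1r; have := normr_ge0 (b - a); lra.
have te : t * (2 * (`|b - a| + eps)) = eps by rewrite /t divfK// gt_eqF.
have t01 : 0 < t <= 1 by rewrite t0.
exists (mixv t u v x)%:num; split.
  by apply: piece_dom_in_region vr _ qv => //; exact: mixv_in_region.
apply: eB; rewrite /ball /= mixvE// -/a -/b.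
rewrite (_ : a - _ = - (t * (b - a))); last by ring.
rewrite normrN normrM (ger0_norm (ltW t0)).
by have := mulr_gt0 t0 e0; lra.
Qed.

(** The piece met by [v] has every point of the closed region in its closure, so a single linear
    expression serves all corners at once. *)
Lemma closure_val_affine e x : exists q, q \in pl_pieces P p e x /\
  piece_dom q (v x)%:num /\ forall u, closed_region u r ->
    closure_val (pl_pieces P p e x) (u x)%:num = piece_val q (u x)%:num.
Proof.
have [q qq qv] := guard_piece e x; exists q; split=> //; split=> // u uc.
apply: (closure_valE (I := clock_range (guard p) x) (f := pl_fun P p e x)) => //.
- exact: pl_partition.
- exact: clock_range_interval.
- exact: pl_continuous.
- by move=> q' c q'q; exact: pl_linear.
- exact: closed_region_closure.
Qed.

Lemma corner_prob_affine e : exists (a : R) (b : X -> R),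
  forall u, closed_region u r -> corner_prob P p u e = a + \sum_x b x * (u x)%:num.
Proof.
pose q x := projT1 (cid (closure_val_affine e x)).
exists (\sum_x ratr (q x).1.2), (fun x => ratr (q x).2) => u uc.
rewrite -big_split; apply: eq_bigr => x _ /=.
by have [_ [_ E]] := projT2 (cid (closure_val_affine e x)); exact: E.
Qed.

Lemma corner_prob_template u e : in_region u r -> corner_prob P p u e = template p u e.
Proof.
move=> ur; rewrite (@pl_template _ _ _ P) ?in_region_guard//.
apply: eq_bigr => x _; have [q [qq [qv E]]] := closure_val_affine e x.
rewrite E; last exact: in_closed_region.
apply/esym/(pl_linear pp qq).
exact: (piece_dom_in_region k0 vr ur).
Qed.

(** Links [corner_prob] at a boundary point, where the guard may fail, to [template] inside the
    region, where it holds; sign and total mass are deduced from this identity. *)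
Lemma corner_prob_mixv t u e : closed_region u r -> 0 < t <= 1 ->
  template p (mixv t u v) e = (1 - t) * corner_prob P p u e + t * template p v e.
Proof.
move=> uc t01; have mr := mixv_in_region k0 uc vr t01.
rewrite -!corner_prob_template//; have [a [b E]] := corner_prob_affine e.
rewrite !E//; [|exact: in_closed_region..].
under eq_bigr do rewrite mixvE// mulrDr ![b _ * (_ * _)]mulrCA.
by rewrite big_split/= -!mulr_sumr; ring.
Qed.

Lemma template_sum1 u : in_region u r -> \sum_e template p u e = 1.
Proof.
move=> ur; have ug := in_region_guard ur; rewrite -(pl_sum1 pp ug).
by apply: eq_bigr => e _; exact: pl_template.
Qed.

Lemma corner_prob_ge0 u e : closed_region u r -> 0 <= corner_prob P p u e.
Proof.
move=> uc; apply: (@segment_ge0 _ _ (template p v e)) => t t01.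
by rewrite -corner_prob_mixv// dist_ge0.
Qed.

Let half01 : 0 < (2^-1 : R) <= 1.
Proof. lra. Qed.

Lemma corner_prob_sum1 u : closed_region u r -> \sum_e corner_prob P p u e = 1.
Proof.
move=> uc; have := template_sum1 (mixv_in_region k0 uc vr half01).
under eq_bigr do rewrite corner_prob_mixv//.
by rewrite big_split/= -!mulr_sumr template_sum1//; lra.
Qed.

(** Prepares the use of [target_inv], which needs a valuation satisfying the guard: positivity at a
    boundary point persists at the midpoint with [v]. *)
Lemma corner_prob_gt0 u e : closed_region u r -> 0 < corner_prob P p u e ->
  exists2 w, in_region w r & 0 < template p w e.
Proof.
move=> uc c0; exists (mixv 2^-1 u v); first exact: mixv_in_region.
by rewrite corner_prob_mixv//; have := dist_ge0 (template p v) e; lra.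
Qed.

Lemma corner_prob_combination u (lam : nat -> R) : closed_region u r ->
  \sum_(j < size (reg_parts r)) lam j = 1 ->
  (forall x, (u x)%:num =
     \sum_(j < size (reg_parts r)) lam j * (corner R r j x)%:num) ->
  forall e, corner_prob P p u e =
    \sum_(j < size (reg_parts r)) lam j * corner_prob P p (corner R r j) e.
Proof.
move=> uc l1 uE e; have [a [b E]] := corner_prob_affine e.
have Ej j := E _ (corner_closed R k0 r j).
rewrite E//; under [RHS]eq_bigr do rewrite Ej mulrDr.
rewrite big_split/= -mulr_suml l1 mul1r; congr (_ + _).
under eq_bigr do rewrite uE mulr_sumr.
rewrite exchange_big/=; apply: eq_bigr => j _; rewrite mulr_sumr.
by apply: eq_bigr => x _; rewrite mulrCA.
Qed.

End CornerProbabilities.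

(** * Region of a valuation, reset of a region, coarsening *)

Section RegionMaps.
Variables (R : realType) (X : finType).

Definition region_of k M (v : valuation R X) : region X k M :=
  xget (region0 X k M) [set r | in_region v r].

Lemma in_region_of k M (v : valuation R X) : (0 < k)%N ->
  (forall x, (v x)%:num <= M%:R) -> in_region v (region_of k M v).
Proof.
move=> k0 vM; have [r vr] := region_exists k0 vM.
by rewrite /region_of; case: xgetP => [r' -> //|/(_ r)].
Qed.

(** For positive [k] the default is never met: a reset valuation keeps the bound [M], hence lies in
    some region, the same for all valuations of [r]. *)
Definition reset_region k M (r : region X k M) (Y : {set X}) : region X k M :=
  xget r [set r' | is_reset R r Y r'].

Lemma reset_bound (v : valuation R X) Y M : (forall x, (v x)%:num <= M%:R) ->
  forall x, (reset v Y x)%:num <= M%:R.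
Proof. by move=> vM x; rewrite ffunE; case: ifP => //=; rewrite ler0n. Qed.

Lemma in_reset_region k M (r : region X k M) Y (v : valuation R X) : (0 < k)%N -> in_region v r ->
  in_region (reset v Y) (reset_region r Y).
Proof.
move=> k0 vr; rewrite /reset_region; case: xgetP => [r' -> /(_ v vr)//|N].
have [r' vr'] : exists r' : region X k M, in_region (reset v Y) r'.
  by apply: region_exists => //; apply: reset_bound => x; exact: in_region_bound vr.
case: (N r') => u ur; exact: (reset_in_region k0 ur vr vr').
Qed.

Lemma is_resetE k M (r r' : region X k M) Y : (0 < k)%N ->
  is_reset R r Y r' <-> reset_region r Y = r'.
Proof.
move=> k0; split=> [rr'|<- v vr]; last exact: in_reset_region.
have [v vr] := in_region_nonempty R k0 r.
exact: (in_region_inj k0 (in_reset_region Y k0 vr) (rr' v vr)).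
Qed.

(** If [n] is the integer part at granularity [2 * k], then at granularity [k] the integer part is
    [n./2] and the fraction is half of parity plus offset. *)
Lemma refine_in_region k M (r2 : region X (2 * k) M) (r : region X k M)
    (u v : valuation R X) :
  (0 < k)%N -> in_region u r2 -> in_region v r2 -> in_region v r -> in_region u r.
Proof.
move=> k0 u2 v2 vr; have k20 : (0 < 2 * k)%N by rewrite muln_gt0.
pose n x := nat_of_ord (reg_h r2 x).
have E (w : valuation R X) x : in_region w r2 ->
    Num.floor (k%:R * (w x)%:num) = ((n x)./2)%:Z /\
    kfrac k w x = (odd (n x))%:R / 2 + off r2 w x / 2.
  move=> w2; have /(in_regionE k20)[/(_ x)/andP[h1 h2] _ _] := w2.
  have F : k%:R * (w x)%:num = ((n x)./2)%:R + (odd (n x))%:R / 2 + off r2 w x / 2.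
    have : (n x)%:R = (odd (n x))%:R + 2 * ((n x)./2)%:R :> R.
      by rewrite -natrM -natrD mul2n odd_double_half.
    rewrite /off natrM -/(n x); lra.
  have fl : Num.floor (k%:R * (w x)%:num) = ((n x)./2)%:Z.
    apply: floor_def; rewrite intrD mulr1z -!pmulrn F.
    by case: (odd _) => /=; lra.
  by split=> //; rewrite /kfrac fl F -!pmulrn; ring.
have [_ z2 o2] := region_same k20 u2 v2.
apply: (same_region k0 vr) => [x|x|x y].
- by rewrite (E _ _ u2).1 (E _ _ v2).1.
- rewrite (E _ _ u2).2 (E _ _ v2).2.
  have := z2 x; rewrite (kfracE _ u2) (kfracE _ v2) => z.
  have /(in_regionE k20)[/(_ x)/andP[hu _] _ _] := u2.
  have /(in_regionE k20)[/(_ x)/andP[hv _] _ _] := v2.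
  case: (odd _) => /=; first by split; lra.
  by split=> h; have h' := h; [have := z.1|have := z.2]; lra.
- rewrite !(E _ _ u2).2 !(E _ _ v2).2.
  have := o2 x y; rewrite !(kfracE _ u2) !(kfracE _ v2) => o.
  have /(in_regionE k20)[hu _ _] := u2; have /(in_regionE k20)[hv _ _] := v2.
  have := hu x; have := hu y; have := hv x; have := hv y.
  (* Equal parities: the fractions compare as the offsets do. Different parities: the odd clock has
     fraction at least 1/2, the even one less, so the order is settled. *)
  case: (odd _); case: (odd _) => /=.
  + by split=> h; [suff : off r2 v x <= off r2 v y by lra|
      suff : off r2 u x <= off r2 u y by lra]; apply/o; lra.
  + by split; lra.
  + by split; lra.
  + by split=> h; [suff : off r2 v x <= off r2 v y by lra|
      suff : off r2 u x <= off r2 u y by lra]; apply/o; lra.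
Qed.

Definition coarsen k M (r2 : region X (2 * k) M) : region X k M :=
  xget (region0 X k M) [set r | forall v : valuation R X, in_region v r2 -> in_region v r].

Lemma in_coarsen k M (r2 : region X (2 * k) M) (v : valuation R X) : (0 < k)%N ->
  in_region v r2 -> in_region v (coarsen r2).
Proof.
move=> k0 vr2; have k20 : (0 < 2 * k)%N by rewrite muln_gt0.
rewrite /coarsen; case: xgetP => [r' -> /(_ v vr2)//|N].
have [r vr] : exists r : region X k M, in_region v r.
  by apply: region_exists => // x; exact: in_region_bound vr2.
by case: (N r) => u ur; exact: refine_in_region ur vr2 vr.
Qed.

End RegionMaps.

Lemma point_dist_wmass (R : realType) (Q : choiceType) (q s : Q) :
  point_dist R q s = wmass [:: (1, q)] s.
Proof. by rewrite wmassE big_seq1 mul1r /= eq_sym. Qed.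

Lemma point_list_ge0 (R : realType) (Q : choiceType) (q : Q) :
  {in [:: (1 : R, q)], forall z, 0 <= z.1}.
Proof. by move=> z; rewrite inE => /eqP ->; rewrite /= ler01. Qed.

Lemma finite_supp_point_dist (R : realType) (Q : choiceType) (q : Q) :
  finite_set (supp (point_dist R q)).
Proof.
exact: (finite_supp_wmass (@point_list_ge0 R Q q) (point_dist_wmass R q)).
Qed.

Lemma supp_point_dist (R : realType) (Q : choiceType) (q s : Q) :
  supp (point_dist R q) s -> s = q.
Proof. by rewrite /supp /=; case: eqP => //; rewrite ltxx. Qed.

Lemma push_point_dist (R : realType) (Q1 Q2 : choiceType) (h : Q1 -> Q2) q s :
  push h (point_dist R q) s = point_dist R (h q) s.
Proof.
by rewrite (push_wmass _ _ (@point_list_ge0 R Q1 q) (point_dist_wmass R q))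
  point_dist_wmass.
Qed.

(** * Corner transitions and reachable states of the region graph *)

Section RegionGraph.
Variables (R : realType) (X L : finType) (P : cdpta R X L) (k M : nat).
Hypothesis k0 : (0 < k)%N.
Implicit Types (r : region X k M) (u v : valuation R X) (p : edge R X L).

(** Indexed by outcomes rather than by states: different resets may lead to the same region, and
    [wmass] adds their probabilities. *)
Definition corner_list r p u : seq (R * rg_state X L k M) :=
  [seq (corner_prob P p u e, (e.2, reset_region R r e.1))
     | e <- enum [the finType of ({set X} * L)%type]].

Lemma wmass_corner_listE r p u s : wmass (corner_list r p u) s =
  \sum_e corner_prob P p u e * ((e.2, reset_region R r e.1) == s)%:R.
Proof. by rewrite wmassE big_map big_enum. Qed.

Lemma wmass_corner_list r p u l' r' : wmass (corner_list r p u) (l', r') =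
  \sum_(Y : {set X} | `[< is_reset R r Y r' >]) corner_prob P p u (Y, l').
Proof.
rewrite wmass_corner_listE [RHS]big_mkcond/=.
transitivity (\sum_(Y : {set X}) \sum_(l : L) corner_prob P p u (Y, l) *
    ((l, reset_region R r Y) == (l', r') :> rg_state X L k M)%:R).
  by rewrite pair_bigA; apply: eq_bigr => -[].
apply: eq_bigr => Y _; rewrite (bigD1 l')//= big1 ?addr0 => [|l ll]; last first.
  by case: eqP => [[/eqP]|_]; rewrite ?(negbTE ll) ?mulr0.
case: asboolP => [/(@is_resetE R X k M r r' Y k0) ->|nr].
  by rewrite eqxx mulr1.
by case: eqP => [[/(@is_resetE R X k M r r' Y k0)]|_]//; rewrite mulr0.
Qed.

Section Edge.
Variables (p : edge R X L) (r : region X k M) (v : valuation R X).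
Hypotheses (pp : prob P p) (vr : in_region v r) (vg : sat v (guard p)).

Lemma corner_list_ge0 u : closed_region u r ->
  {in corner_list r p u, forall z, 0 <= z.1}.
Proof. by move=> uc z /mapP[e _ ->] /=; exact: corner_prob_ge0 vg _ _ uc. Qed.

Lemma corner_list_sum1 u : closed_region u r -> \sum_(z <- corner_list r p u) z.1 = 1.
Proof.
by move=> uc; rewrite big_map big_enum/= (corner_prob_sum1 k0 pp vr vg uc).
Qed.

(** Stated for the closed region because it is applied both to a valuation of the region and to a
    corner of a finer region. The convex weights of the corners become the probabilities of the
    corner transitions, as [corner_prob] is affine. *)
Lemma corner_lift u : closed_region u r ->
  exists l : seq (R * trans (region_graph P k M)),
  [/\ {in l, forall z, 0 <= z.1}, \sum_(z <- l) z.1 = 1,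
      {in l, forall z, rg_prob P z.2 /\ z.2.1.1 = (src p, r)} &
      forall s, \sum_(z <- l) z.1 * z.2.2 s = wmass (corner_list r p u) s].
Proof.
move=> uc; have [lam [lam0 lam1 uE]] := corner_combination k0 uc.
have cc j := corner_closed R k0 r j.
pose nu j := wdist (corner_list_ge0 (cc j)) (corner_list_sum1 (cc j)).
exists [seq (lam j, ((src p, r), Corner (corner R r j) p, nu j))
  | j <- index_iota 0 (size (reg_parts r))]; split.
- by move=> z /mapP[j _ ->]; exact: lam0.
- by rewrite big_map big_mkord.
- move=> z /mapP[j]; rewrite mem_index_iota => /= jn ->; split=> //=.
  exists (src p), r, (corner R r j), p, (nu j); split=> //.
  + by move=> w wr; exact: (in_region_guard k0 vr vg wr).
  + by exists j.
  + by move=> l' r'; rewrite -wmass_corner_list.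
- move=> s; rewrite big_map big_mkord/= wmass_corner_listE.
  under eq_bigr do rewrite [X in _ * X]wmass_corner_listE mulr_sumr.
  rewrite exchange_big/=; apply: eq_bigr => e _.
  rewrite (corner_prob_combination k0 pp vr vg uc lam1 uE) mulr_suml.
  by apply: eq_bigr => j _; rewrite mulrA.
Qed.
End Edge.

Lemma val0_in_region0 : in_region (val0 R X) (region0 X k M).
Proof.
have r0 x : off (region0 X k M) (val0 R X) x = 0.
  by rewrite /off /val0 !ffunE /= mulr0 subrr.
have b0 x : block (region0 X k M) x = 0%N by rewrite /block /= inE.
by apply/(in_regionE k0); split=> [x|x|x y]; rewrite ?r0 ?b0 ?lexx ?ltr01.
Qed.

(** Such a valuation enables the zero delay, which yields liveness of the region graph along
    runs. *)
Lemma region_run_inv (rho : seq (step (region_graph P k M))) : is_run rho ->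
  exists2 v : valuation R X, in_region v (last_state rho).2 & sat v (Defs.inv P (last_state rho).1).
Proof.
elim/last_ind: rho => [_|rho st IH].
  rewrite /last_state /=; exists (val0 R X); last exact: inv_loc0.
  exact: val0_in_region0.
rewrite is_run_rcons last_state_rcons => -[/IH[v vr vi] [+ sst]].
case=> [[l [r [r' []]]]|[l [r [alpha [p [nu []]]]]]].
  case=> _ _ e [w [d [_ wr' wi]]]; move: sst; rewrite e => /supp_point_dist ->.
  by exists (elapse w d) => //; exact: wi.
case=> el _ e [pp pl] rg [j /= js ja] nuE.
move: sst; rewrite e /supp; case: st.2 => l' r' /=; rewrite nuE.
have [w wr] := in_region_nonempty R k0 r; have wg := rg _ wr.
have cc : closed_region alpha r by rewrite -ja; exact: corner_closed.
rewrite -wmass_corner_list => /(wmass_gt0P (corner_list_ge0 pp wr wg cc)).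
move=> [_ /mapP[[Y l1] _ ->] /= [[<- <-] c0]].
have [w' wr' t0] := corner_prob_gt0 k0 pp wr wg cc c0.
exists (reset w' Y); first exact: in_reset_region.
by apply: (target_inv pp _ t0); exact: (in_region_guard k0 wr wg wr').
Qed.

End RegionGraph.

(** * The two simulations *)

Section Comparison.
Variables (R : realType) (X L : finType) (P : cdpta R X L) (M : nat).

Lemma elapse0 (v : valuation R X) (d : {nonneg R}) :
  d%:num <= 0 -> elapse v d = v.
Proof.
move=> d0; have e : d%:num = 0 by apply/le_anti; rewrite d0 ge0.
by apply/ffunP => x; rewrite ffunE; apply: val_inj; rewrite /= e addr0.
Qed.

Section Region.
Variable k : nat.
Hypothesis k0 : (0 < k)%N.

Lemma region_graph_live (rho : seq (step (region_graph P k M))) : is_run rho ->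
  exists t : trans (region_graph P k M), Delta t /\ t.1.1 = last_state rho.
Proof.
move=> /(region_run_inv k0)[v vr vi].
exists (last_state rho, Tau _ _ _, point_dist R (last_state rho)); split=> //.
left; case: (last_state rho) vr vi => l r /= vr vi.
exists l, r, r; split=> //; exists v, 0%:nng; split=> //; first by rewrite elapse0.
by move=> d d0; rewrite elapse0.
Qed.

Lemma rg_prob_wmass (t : rg_state X L k M * rg_act R X L * Dist R (rg_state X L k M)) :
  rg_prob P t -> exists p (v : valuation R X), [/\ prob P p, src p = t.1.1.1, in_region v t.1.1.2,
    sat v (guard p) & exists2 u, corner_points t.1.1.2 u &
      forall s, t.2 s = wmass (corner_list P t.1.1.2 p u) s].
Proof.
case=> l [r [alpha [p [nu [-> [pp pl] rg ca nuE]]]]] /=.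
have [v vr] := in_region_nonempty R k0 r.
exists p, v; split=> //; first exact: rg.
by exists alpha => // -[l' r']; rewrite nuE wmass_corner_list.
Qed.

Lemma region_graph_finite_supp (t : trans (region_graph P k M)) :
  Delta t -> finite_set (supp t.2).
Proof.
case=> [[l [r [r' [-> _]]]]|]; first exact: finite_supp_point_dist.
move=> /rg_prob_wmass[p [v [pp _ vr vg [_ [j _ <-] E]]]].
apply: finite_supp_wmass E; apply: (corner_list_ge0 k0 pp vr vg).
exact: corner_closed.
Qed.

Lemma region_graph_disjoint (t : trans (region_graph P k M)) :
  rg_delay P t -> rg_prob P t -> False.
Proof. by move=> [l [r [r' [-> _]]]] [l' [r1 [a [p [nu []]]]]]. Qed.

End Region.

Lemma sem_disjoint (t : trans (sem P)) : sem_delay t -> sem_prob t -> False.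
Proof. by move=> [s [s' [d [-> _ _ _]]]] [s1 [p [mu []]]]. Qed.

(* The default of insubd is only met with weight 0. *)
Definition sem_list (s : sem_state P) (p : edge R X L) : seq (R * sem_state P) :=
  [seq (template p (clk s) e, insubd s (e.2, reset (clk s) e.1))
     | e <- enum [the finType of ({set X} * L)%type]].

Lemma sem_list_ge0 s p : {in sem_list s p, forall z, 0 <= z.1}.
Proof. by move=> z /mapP[e _ ->]; exact: dist_ge0. Qed.

Lemma sem_listE (s : sem_state P) p e : prob P p -> sat (clk s) (guard p) ->
  0 < template p (clk s) e ->
  val (insubd s (e.2, reset (clk s) e.1) : sem_state P) = (e.2, reset (clk s) e.1).
Proof.
move=> pp sg t0; rewrite val_insubd (target_inv pp sg)//.
by case: e t0.
Qed.

Lemma sem_prob_wmass (s : sem_state P) p (mu : Dist R (sem_state P)) :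
  prob P p -> sat (clk s) (guard p) ->
  (forall s' : sem_state P, mu s' = \sum_(Y : {set X} | reset (clk s) Y == clk s')
     template p (clk s) (Y, loc s')) ->
  forall s', mu s' = wmass (sem_list s p) s'.
Proof.
move=> pp sg muE s'; rewrite muE wmassE big_map big_enum/= big_mkcond/=.
transitivity (\sum_(Y : {set X}) \sum_(l : L) template p (clk s) (Y, l) *
    ((l, reset (clk s) Y) == val s')%:R).
  apply: eq_bigr => Y _; rewrite (bigD1 (loc s'))//= big1 ?addr0 => [|l ll]; last first.
    by rewrite -pair_eqE /= (negbTE ll) mulr0.
  by rewrite -pair_eqE /= eqxx; case: eqP; rewrite ?mulr1 ?mulr0.
rewrite pair_bigA; apply: eq_bigr => -[Y l] _ /=.
have := dist_ge0 (template p (clk s)) (Y, l).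
rewrite le_eqVlt => /predU1P[<-|t0]; first by rewrite !mul0r.
by rewrite -val_eqE (sem_listE pp sg t0).
Qed.

Lemma sem_finite_supp (t : trans (sem P)) : Delta t -> finite_set (supp t.2).
Proof.
case=> [[s [s' [d [-> _ _ _]]]]|]; first exact: finite_supp_point_dist.
move=> [s [p [mu [-> pp _ sg muE]]]].
exact: (finite_supp_wmass (@sem_list_ge0 s p) (sem_prob_wmass pp sg muE)).
Qed.

Lemma sem_reach_values (F : {set L}) k : (0 < k)%N -> clock_bound P M ->
  reach_values (cdpta_strategies P) (sem_target P F) `<=`
  reach_values (region_strategies P k M) (region_target P k M F).
Proof.
move=> k0 hM.
pose h (s : state (sem P)) : state (region_graph P k M) :=
  (loc (s : sem_state P), region_of k M (clk (s : sem_state P))).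
have clkR (s : sem_state P) : in_region (clk s) (region_of k M (clk s)).
  by apply: in_region_of => // x; apply: hM; exact: (valP s).
apply: (@simulation_reach_values R (sem P) (region_graph P k M) h) => //.
- exact: sem_disjoint.
- exact: region_graph_disjoint.
- exact: sem_finite_supp.
- exact: region_graph_finite_supp.
- exact: region_graph_live.
- congr (_, _); apply: (in_region_inj k0 (clkR (sem_init P))).
  exact: val0_in_region0.
- move=> t [s [s' [d [-> ls cs di]]]].
  exists [:: (1, (h s, Tau _ _ _, point_dist R (h s')))]; split; last first.
    move=> z; rewrite inE => /eqP -> /=.
    exists (loc s), (region_of k M (clk s)), (region_of k M (clk s')).
    split; first by rewrite /h ls.
    by exists (clk s), d; split=> //; rewrite -cs.
  split.
  + by move=> z; rewrite inE => /eqP ->; rewrite /= ler01.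
  + by rewrite big_seq1.
  + by move=> z; rewrite inE => /eqP ->.
  + by move=> s2; rewrite big_seq1 mul1r /= push_point_dist.
- move=> t [s [p [mu [-> pp ps sg muE]]]].
  have cs := clkR s.
  have [l [l0 l1 lp lE]] := corner_lift k0 pp cs sg (in_closed_region k0 cs).
  exists l; split; last by move=> z /lp[].
  split=> // [z /lp[_ ->]|s2]; first by rewrite ps.
  rewrite lE /= (push_wmass _ _ (@sem_list_ge0 s p) (sem_prob_wmass pp sg muE)).
  rewrite wmass_corner_listE wmassE /sem_list 2!big_map big_enum/=; apply: eq_bigr => e _.
  (* The valuation is a point of its own region, and there [corner_prob] is the actual
     [template]. *)
  rewrite (corner_prob_template k0 pp cs sg)//.
  have := dist_ge0 (template p (clk s)) e.
  rewrite le_eqVlt => /predU1P[<-|t0]; first by rewrite !mul0r.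
  have E := sem_listE pp sg t0; rewrite /h /loc /clk E /=.
  congr (_ * ((_, _) == _)%:R).
  apply: (in_region_inj k0 (in_reset_region e.1 k0 cs)).
  by apply: in_region_of => //; apply: reset_bound => x; apply: hM; exact: (valP s).
Qed.

Lemma refined_reach_values (F : {set L}) k : (0 < k)%N ->
  reach_values (region_strategies P (2 * k) M) (region_target P (2 * k) M F) `<=`
  reach_values (region_strategies P k M) (region_target P k M F).
Proof.
move=> k0; have k20 : (0 < 2 * k)%N by rewrite muln_gt0.
pose h (s : state (region_graph P (2 * k) M)) : state (region_graph P k M) :=
  (s.1, coarsen R s.2).
have coarse (r : region X (2 * k) M) (v : valuation R X) :
  in_region v r -> in_region v (coarsen R r) by exact: in_coarsen.
apply: (@simulation_reach_values R (region_graph P (2 * k) M) (region_graph P k M) h) => //.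
- exact: region_graph_disjoint.
- exact: region_graph_disjoint.
- exact: region_graph_finite_supp.
- exact: region_graph_finite_supp.
- exact: region_graph_live.
- congr (_, _); apply: (in_region_inj k0 (v := val0 R X)).
    by apply: coarse; exact: val0_in_region0.
  exact: val0_in_region0.
- move=> t [l [r [r' [-> [v [d [vr vr' di]]]]]]].
  exists [:: (1, (h (l, r), Tau _ _ _, point_dist R (h (l, r'))))]; split; last first.
    move=> z; rewrite inE => /eqP -> /=.
    exists l, (coarsen R r), (coarsen R r'); split=> //.
    by exists v, d; split=> //; exact: coarse.
  split.
  + by move=> z; rewrite inE => /eqP ->; rewrite /= ler01.
  + by rewrite big_seq1.
  + by move=> z; rewrite inE => /eqP ->.
  + by move=> s2; rewrite big_seq1 mul1r /= push_point_dist.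
- move=> t /(rg_prob_wmass k20)[p [v [pp ps vr vg [u [j _ uj] E]]]].
  have uc2 : closed_region u t.1.1.2 by rewrite -uj; exact: corner_closed.
  have cs := coarse _ _ vr.
  have uc : closed_region u (coarsen R t.1.1.2).
    (* Points strictly between the corner and [v] lie in the fine region, hence in the coarse one;
       the corner is their limit. *)
    apply: (closed_region_lim k0 (v := v)) => a a01; apply: coarse.
    exact: mixv_in_region.
  have [l [l0 l1 lp lE]] := corner_lift k0 pp cs vg uc.
  exists l; split; last by move=> z /lp[].
  split=> // [z /lp[_ ->]|s2]; first by rewrite ps.
  rewrite lE (push_wmass _ _ (corner_list_ge0 k20 pp vr vg uc2) E).
  rewrite wmass_corner_listE wmassE /corner_list 2!big_map big_enum/=; apply: eq_bigr => e _.
  congr (_ * ((_, _) == _)%:R).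
  (* Reset and coarsening commute, since both results contain the same reset of [v]. *)
  apply: (in_region_inj k0 (in_reset_region e.1 k0 cs)).
  by apply: coarse; exact: in_reset_region.
Qed.

End Comparison.

Theorem proposition1 (R : realType) (X L : finType) (P : cdpta R X L) (M : nat)
    (hM : clock_bound P M) (F : {set L}) (k : nat) (hk : (0 < k)%N) :
  ((Pmax (cdpta_strategies P) (sem_target P F) <=
      Pmax (region_strategies P k M) (region_target P k M F))%E /\
   (Pmin (cdpta_strategies P) (sem_target P F) >=
      Pmin (region_strategies P k M) (region_target P k M F))%E) /\
  ((Pmax (region_strategies P (2 * k) M) (region_target P (2 * k) M F) <=
      Pmax (region_strategies P k M) (region_target P k M F))%E /\
   (Pmin (region_strategies P (2 * k) M) (region_target P (2 * k) M F) >=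
      Pmin (region_strategies P k M) (region_target P k M F))%E).
Proof.
have sub1 := @sem_reach_values R X L P M F k hk hM.
have sub2 := @refined_reach_values R X L P M F k hk.
by split; split; [exact: le_ereal_sup|exact: le_ereal_inf|
  exact: le_ereal_sup|exact: le_ereal_inf].
Qed.
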